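(* Assume CECA. Let $\sigma,\tau$ be regular infinite cardinals, let $\kappa$ be a cardinal, and let $\langle A_\alpha\rangle_{\alpha<\kappa}$ be a sequence of (not necessarily distinct) sets such that one of the following conditions is satisfied: (1.1) for every $I\in[\kappa]^\tau$ there is a nonempty $J\in[I]^{<\tau}$ such that $|\bigcap_{\alpha\in J}A_\alpha|<\sigma$; (1.2) for every $I\in[\kappa]^\tau$ there is a nonempty $J\in[I]^{<\tau}$ such that $|\bigcap_{\alpha\in J}A_\alpha|\le\sigma$, and for every $S\in[\bigcup_{\alpha<\kappa}A_\alpha]^\sigma$ we have $|\{\alpha<\kappa:S\subset A_\alpha\}|\le\sigma$. Then there exist sets $\langle A'_\alpha\rangle_{\alpha<\kappa}$ such that $|A'_\alpha|\le\sigma$ for each $\alpha<\kappa$ and the sequence $\langle A_\alpha\setminus A'_\alpha\rangle_{\alpha<\kappa}$ is point-$<\tau$.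
   Context: $[X]^{\tau}$ (resp. $[X]^{<\tau}$) is the set of subsets of $X$ of cardinality $\tau$ (resp. $<\tau$). $H(\Theta)$ is the set of all sets hereditarily of cardinality $<\Theta$. A sequence $\langle B_\alpha\rangle_{\alpha<\kappa}$ of sets is point-$<\tau$ if $\bigcap_{\alpha\in I}B_\alpha=\emptyset$ for every $I\in[\kappa]^\tau$. For an infinite regular cardinal $\tau$, a set $M$ is weakly $\tau$-closed if for every $I\in[M]^\tau$ there is $J\in[I]^\tau$ with $[J]^{<\tau}\subset M$. $M$ is weakly closed if it is weakly $\tau$-closed for all regular infinite $\tau$. An $\in$-chain is a sequence $\langle M_\xi:\xi<\alpha\rangle$ such that $M_\xi\subset M_\eta$ and $\langle M_\xi:\xi\le\eta\rangle\in M_{\eta+1}$ for all $\xi<\eta<\alpha$ (the latter whenever $\eta+1<\alpha$); it is continuous if unions are taken at limit indices. $\mathrm{CECA}(\lambda)$: for every regular cardinal $\Theta>\lambda$ and all sets $A\subset H(\Theta)$, $B\in H(\Theta)$ with $|A|=\lambda$, $|B|<\lambda$, there is a continuous $\in$-chain $\langle M_\xi\rangle_{\xi<cf(\lambda)}$ of weakly closed elementary submodels of $H(\Theta)$ such that $|M_\xi|<\lambda$ for every $\xi<cf(\lambda)$, $B\in M_0$, and $A\subset\bigcup_{\xi<cf(\lambda)}M_\xi$. CECA: $\mathrm{CECA}(\lambda)$ holds for all uncountable cardinals $\lambda$. *)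

(* Defs.v *)
From mathcomp Require Import all_boot.
From mathcomp Require Import mathcomp_extra boolp classical_sets functions.
From mathcomp Require Import cardinality.

Set Implicit Arguments.
Unset Strict Implicit.
Unset Printing Implicit Defensive.

Local Open Scope classical_set_scope.
Local Open Scope card_scope.

Declare Scope zfc_scope.
Delimit Scope zfc_scope with zfc.
Local Open Scope zfc_scope.

(* A universe of sets satisfying ZFC, the schemas of separation and
   replacement ranging over all relations of the ambient logic. Hence every
   subclass of a set, and every Rocq function restricted to a set, is
   (represented by) a set: families of sets indexed by a set are given below
   as functions [zfc -> zfc], of which only the values on the index set
   matter, and cardinalities of sets are those of MathComp-Analysis. *)
Record zfc := ZFC {
  zset :> Type;
  zmem : zset -> zset -> Prop;
  zfc_extensionality : forall x y,
    (forall z, zmem z x <-> zmem z y) -> x = y;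
  zfc_foundation : forall x, (exists y, zmem y x) ->
    exists y, zmem y x /\ forall z, zmem z x -> ~ zmem z y;
  zfc_pairing : forall x y, exists z, forall w, zmem w z <-> w = x \/ w = y;
  zfc_union : forall x, exists u, forall w,
    zmem w u <-> exists y, zmem y x /\ zmem w y;
  zfc_powerset : forall x, exists p, forall w,
    zmem w p <-> forall z, zmem z w -> zmem z x;
  zfc_separation : forall x (P : zset -> Prop), exists y, forall w,
    zmem w y <-> zmem w x /\ P w;
  zfc_replacement : forall x (F : zset -> zset -> Prop),
    (forall a b c, zmem a x -> F a b -> F a c -> b = c) ->
    exists y, forall b, zmem b y <-> exists a, zmem a x /\ F a b;
  zfc_infinity : exists w,
    (exists e, (forall z, ~ zmem z e) /\ zmem e w) /\
    (forall x, zmem x w ->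
       exists s, zmem s w /\ forall z, zmem z s <-> zmem z x \/ z = x);
  zfc_choice : forall x,
    (forall y, zmem y x -> exists z, zmem z y) ->
    (forall y y' z, zmem y x -> zmem y' x -> zmem z y -> zmem z y' -> y = y') ->
    exists c, forall y, zmem y x -> exists! z, zmem z y /\ zmem z c
}.

Notation "x ∈ y" := (zmem x y) (at level 70, no associativity) : zfc_scope.

Definition elts (V : zfc) (x : V) : set V := [set y | y ∈ x].

Definition upair (V : zfc) (x y : V) : V := sval (cid (zfc_pairing x y)).

Definition opair (V : zfc) (x y : V) : V := upair (upair x x) (upair x y).

Definition bigunion (V : zfc) (x : V) : V := sval (cid (zfc_union x)).

Definition succ (V : zfc) (x : V) : V := bigunion (upair x (upair x x)).

Definition card_lt (T U : Type) (A : set T) (B : set U) : bool :=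
  (A #<= B) && ~~ (B #<= A).
Notation "A '#<' B" := (card_lt A B) (at level 79) : card_scope.

Definition transitive_set (V : zfc) (x : V) : Prop :=
  forall y, y ∈ x -> elts y `<=` elts x.

Definition ordinal (V : zfc) (x : V) : Prop :=
  transitive_set x /\ forall y, y ∈ x -> transitive_set y.

Definition limit_ordinal (V : zfc) (x : V) : Prop :=
  [/\ ordinal x, elts x !=set0 & forall y, x <> succ y].

(* Initial ordinals, finite ones included. *)
Definition cardinal (V : zfc) (k : V) : Prop :=
  ordinal k /\ forall a, a ∈ k -> ~~ (elts k #<= elts a).

Definition cofinal_map (V : zfc) (l m : V) (f : V -> V) : Prop :=
  (forall x, x ∈ m -> f x ∈ l) /\
  (forall a, a ∈ l -> exists x, x ∈ m /\ (a ∈ f x \/ a = f x)).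

(* m = cf(l) *)
Definition is_cf (V : zfc) (l m : V) : Prop :=
  [/\ ordinal m, exists f, cofinal_map l m f
    & forall n, n ∈ m -> ~ exists f, cofinal_map l n f].

Definition regular (V : zfc) (k : V) : Prop :=
  [/\ cardinal k, infinite_set (elts k) & is_cf k k].

(* [X]^t and [X]^{<t} *)
Definition subsets_card (V : zfc) (X : set V) (t : V) : set V :=
  [set I | elts I `<=` X /\ elts I #= elts t].
Definition subsets_card_lt (V : zfc) (X : set V) (t : V) : set V :=
  [set I | elts I `<=` X /\ elts I #< elts t].

(* H(theta) as a class: x, its elements, their elements, and so on, all have
   fewer than theta elements. For theta regular this amounts to the
   transitive closure of x having fewer than theta elements. *)
Inductive H (V : zfc) (theta : V) : V -> Prop :=
  H_intro x : elts x #< elts theta -> (forall y, y ∈ x -> H theta y) ->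
    H theta x.

(* First-order formulas in the language {∈, =}, with de Bruijn indices. As
   separation is second-order, omega of the universe is isomorphic to nat, so
   these are the formulas of the universe as well. *)
Inductive formula : Type :=
| FMem (i j : nat)
| FEq (i j : nat)
| FNot (phi : formula)
| FAnd (phi psi : formula)
| FEx (phi : formula).

Definition scons (T : Type) (x : T) (e : nat -> T) (n : nat) : T :=
  if n is n'.+1 then e n' else x.

(* phi holds in the structure (D, ∈) under the assignment e *)
Fixpoint sat (V : zfc) (D : set V) (e : nat -> V) (phi : formula) : Prop :=
  match phi with
  | FMem i j => e i ∈ e j
  | FEq i j => e i = e j
  | FNot p => ~ sat D e p
  | FAnd p q => sat D e p /\ sat D e q
  | FEx p => exists x, D x /\ sat D (scons x e) p
  end.

Definition elementary_submodel (V : zfc) (M D : set V) : Prop :=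
  [/\ M !=set0, M `<=` D
    & forall (phi : formula) (e : nat -> V), (forall n, M (e n)) ->
        (sat M e phi <-> sat D e phi)].

Definition weakly_closed_at (V : zfc) (t : V) (M : V) : Prop :=
  forall I, subsets_card (elts M) t I ->
    exists J, subsets_card (elts I) t J /\
      subsets_card_lt (elts J) t `<=` elts M.

Definition weakly_closed (V : zfc) (M : V) : Prop :=
  forall t : V, regular t -> weakly_closed_at t M.

(* s is the sequence <M_x : x in a>, as a set of ordered pairs *)
Definition is_sequence (V : zfc) (a : V) (M : V -> V) (s : V) : Prop :=
  elts s = [set opair x (M x) | x in elts a].

Definition in_chain (V : zfc) (a : V) (M : V -> V) : Prop :=
  forall x y : V, x ∈ y -> y ∈ a ->
    elts (M x) `<=` elts (M y) /\
    (succ y ∈ a -> exists s, is_sequence (succ y) M s /\ s ∈ M (succ y)).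

Definition continuous_chain (V : zfc) (a : V) (M : V -> V) : Prop :=
  forall y : V, y ∈ a -> limit_ordinal y ->
    elts (M y) = \bigcup_(x in elts y) elts (M x).

(* The fourth condition of the second group says B ∈ M_0, the index 0 being
   the empty set. *)
Definition CECA_at (V : zfc) (lambda : V) : Prop :=
  forall theta : V, regular theta -> lambda ∈ theta ->
  forall A B : V, elts A `<=` H theta -> H theta B ->
    elts A #= elts lambda -> elts B #< elts lambda ->
  exists (cf : V) (M : V -> V),
    [/\ is_cf lambda cf, in_chain cf M & continuous_chain cf M] /\
    [/\ forall x, x ∈ cf -> weakly_closed (M x),
        forall x, x ∈ cf -> elementary_submodel (elts (M x)) (H theta),
        forall x, x ∈ cf -> elts (M x) #< elts lambda,
        forall z, (forall y, ~ y ∈ z) -> z ∈ cf -> B ∈ M z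
      & elts A `<=` \bigcup_(x in elts cf) elts (M x)].

Definition CECA (V : zfc) : Prop :=
  forall lambda : V, cardinal lambda -> ~ countable (elts lambda) ->
    CECA_at lambda.

Definition point_lt (V : zfc) (k t : V) (B : V -> set V) : Prop :=
  forall I, subsets_card (elts k) t I ->
    \bigcap_(a in elts I) B a = set0.

(* Main.v *)
(* Restricted to a subset D of kappa, the theorem is proved by induction on |D|.
   Every set of tau indices has a nonempty subset of size < tau over which the
   intersection has at most sigma points, and every set of sigma points lies in
   at most sigma, or in fewer than tau, of the sets. Call a weakly closed set S
   closed if it contains the intersections and the sets of indices determined
   in this way by its own elements. If S is closed, then
   - a point outside S lies in fewer than tau of the sets with index in S;
   - a set with index outside S has at most sigma points in S.
   CECA at the successor of |D| + sigma gives a set X of size |D| + sigma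
   containing all points that lie in at least tau sets; if |D| <= sigma, X can
   be removed from every set. Otherwise CECA at |D| filters D and X into closed
   sets of size < |D|: the levels of a chain of submodels that contain every
   determined small set whose parameter they contain are closed and unbounded.
   From the set of index a one removes its trace on the closed set preceding
   the level at which a appears, and what the induction hypothesis removes for
   the indices that appear at the same level. If x appears at level b and
   remains in the set of index a, then a appears at level at most b; fewer than
   tau such a appear earlier, because x avoids the preceding closed set, and
   fewer than tau appear at level b. *)
From Pilot Require Import Defs.
From mathcomp Require Import all_boot.
From mathcomp Require Import mathcomp_extra boolp classical_sets functions.
From mathcomp Require Import cardinality.
(* Again, because fintype has its own [ordinal]. *)
Import Pilot.Defs.

Set Implicit Arguments.
Unset Strict Implicit.
Unset Printing Implicit Defensive.

Local Open Scope classical_set_scope.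
Local Open Scope card_scope.
Local Open Scope zfc_scope.

(** * Cardinality of classical sets *)

Section Card.
Context {T U : Type}.
Implicit Types (A : set T) (B : set U).

Lemma card_le_inj A B (f : T -> U) : (forall x, A x -> B (f x)) ->
  (forall x y, A x -> A y -> f x = f y -> x = y) -> A #<= B.
Proof.
move=> fAB finj.
have /injfunPex[g] : exists2 f : T -> U, set_fun A B f & set_inj A f.
  by exists f => // x y /set_mem Ax /set_mem Ay; apply: finj.
exact: inj_card_le g.
Qed.

(** The default [u0] is the value outside [A], so that the injection is a total function and
    subtypes can be avoided. *)
Lemma card_leE A B (u0 : U) : A #<= B ->
  exists f : T -> U, (forall x, A x -> B (f x)) /\
    (forall x y, A x -> A y -> f x = f y -> x = y).
Proof.
move=> /card_leP[f].
pose g x := if pselect (A x) is left Ax then set_val (f (SigSub (mem_set Ax))) else u0.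
exists g; split=> [x Ax|x y Ax Ay].
  by rewrite /g; case: pselect => // a; exact: set_valP.
rewrite /g; case: pselect => // a; case: pselect => // b /val_inj.
by move=> /(@inj _ _ _ f) => /(_ (mem_set I) (mem_set I)) [].
Qed.

Lemma card_le_surj A B (f : U -> T) :
  (forall x, A x -> exists y, B y /\ f y = x) -> A #<= B.
Proof.
move=> fAB; apply: card_le_trans (card_image_le f B).
by apply: subset_card_le => x /fAB[y [? ?]]; exists y.
Qed.

Lemma card_leE_surj A B : A !=set0 -> A #<= B ->
  exists f : U -> T, (forall y, B y -> A (f y)) /\
    (forall x, A x -> exists y, B y /\ f y = x).
Proof.
move=> [a Aa] /[dup] AB /card_leP[f0].
have u0 : U by exact: (set_val (f0 (SigSub (mem_set Aa)))).
have [f [fAB finj]] := card_leE u0 AB.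
pose P y x := A x /\ f x = y.
(* [g] inverts [f] on the image of [A] and takes the default value [a] elsewhere. *)
pose g y := if pselect (exists x, P y x) is left e then sval (cid e) else a.
exists g; split=> [y By|x Ax].
  by rewrite /g; case: pselect => // e; case: (cid e) => x [].
exists (f x); split; first exact: fAB.
rewrite /g; case: pselect => [e|]; last by case; exists x.
by case: (cid e) => z /= [Az]; apply: finj.
Qed.

End Card.

Lemma card_ltW (T U : Type) (A : set T) (B : set U) : A #< B -> A #<= B.
Proof. by case/andP. Qed.

Lemma card_ltNge (T U : Type) (A : set T) (B : set U) : A #< B -> ~ (B #<= A).
Proof. by case/andP => _ /negP. Qed.

Lemma card_le_lt_trans (T U W : Type) (A : set T) (B : set U) (C : set W) :
  A #<= B -> B #< C -> A #< C.
Proof.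
move=> AB /andP[BC /negP CB]; apply/andP; split; first exact: card_le_trans BC.
by apply/negP => CA; apply: CB; exact: card_le_trans AB.
Qed.

Lemma card_lt_le_trans (T U W : Type) (A : set T) (B : set U) (C : set W) :
  A #< B -> B #<= C -> A #< C.
Proof.
move=> /andP[AB /negP BA] BC; apply/andP; split; first exact: card_le_trans BC.
by apply/negP => CA; apply: BA; exact: card_le_trans CA.
Qed.

Lemma card_eqW (T U : Type) (A : set T) (B : set U) : A #= B -> A #<= B.
Proof. by case/card_eqPle. Qed.

Lemma card_eq_ge (T U : Type) (A : set T) (B : set U) : A #= B -> B #<= A.
Proof. by case/card_eqPle. Qed.

Lemma finite_lt_infinite (T U : Type) (A : set T) (B : set U) :
  finite_set A -> infinite_set B -> A #< B.
Proof.
move=> /[dup] fA [n An] /[dup] iB /infiniteP NB; apply/andP; split.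
  apply: card_le_trans (card_eqW An) _; apply: card_le_trans NB.
  exact: card_leT.
by apply/negP => BA; apply: iB; exact: card_le_finite BA fA.
Qed.

Lemma infinite_le (T U : Type) (A : set T) (B : set U) :
  A #<= B -> infinite_set A -> infinite_set B.
Proof. by move=> AB iA fB; apply: iA; exact: card_le_finite fB. Qed.

Lemma cantor (T : Type) (A : set T) (f : T -> set T) :
  exists X : set T, X `<=` A /\ forall x, A x -> f x <> X.
Proof.
exists [set x | A x /\ ~ f x x]; split=> [x []//|x Ax fx].
have nfx : ~ f x x by rewrite fx => -[_ h]; apply: (h); rewrite fx.
by apply: (nfx); rewrite fx.
Qed.

Lemma choice_operator (T : Type) (x0 : T) :
  exists e : set T -> T, forall P : set T, P !=set0 -> P (e P).
Proof.
have [e eP] : {e : set T -> T & forall P, P !=set0 -> P (e P)}.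
  apply: (@choice _ _ (fun P x => P !=set0 -> P x)) => P.
  by have [[x Px]|nP] := pselect (P !=set0); [exists x|exists x0 => /nP].
by exists e.
Qed.

(* Transfinite recursion, always choosing an unused value, embeds P into B as
   long as no initial segment of P is large enough to exhaust B. *)
Lemma card_le_greedy (T U : Type) (P : set T) (B : set U) (R : T -> T -> Prop)
    (u0 : U) : well_founded R ->
  (forall x y, P x -> P y -> R x y \/ x = y \/ R y x) ->
  (forall x, P x -> ~ (B #<= [set y | P y /\ R y x])) ->
  P #<= B.
Proof.
move=> wfR tri small; have [e eP] := choice_operator u0.
pose G x (rec : forall y, R y x -> U) : U :=
  e [set u | B u /\ forall y (h : R y x), P y -> rec y h <> u].
pose F := Fix wfR (fun=> U) G.
have FE x : F x = G x (fun y _ => F y).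
  rewrite /F Fix_eq // => y f g fg; congr G.
  by apply: functional_extensionality_dep => z; apply: functional_extensionality_dep.
have FP x : P x -> B (F x) /\ forall y, R y x -> P y -> F y <> F x.
  move=> Px; rewrite FE.
  apply: (eP [set u | B u /\ forall y, R y x -> P y -> F y <> u]).
  apply: contrapT => h; apply: (small x Px).
  apply: (@card_le_surj _ _ _ _ F) => b Bb; apply: contrapT => nb; apply: h.
  by exists b; split=> // y Ryx Py Fy; apply: nb; exists y.
apply: (@card_le_inj _ _ _ _ F) => [x /FP[]//|x y Px Py Fxy].
have [h|[//|h]] := tri x y Px Py.
  by have [_ /(_ _ h Px)] := FP y Py.
by have [_ /(_ _ h Py)] := FP x Px; rewrite Fxy.
Qed.

(** * Sets of the universe *)

Section Sets.
Context {V : zfc}.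
Implicit Types (x y z w a b c k : V) (P : set V).

Definition zsep x P : V := sval (cid (zfc_separation x P)).
Definition zpow x : V := sval (cid (zfc_powerset x)).

Lemma in_zsep x P z : z ∈ zsep x P <-> z ∈ x /\ P z.
Proof. by rewrite /zsep; case: cid => y /= yP. Qed.

Lemma in_zpow x z : z ∈ zpow x <-> elts z `<=` elts x.
Proof. by rewrite /zpow; case: cid => y /= yP. Qed.

Lemma in_upair x y z : z ∈ upair x y <-> z = x \/ z = y.
Proof. by rewrite /upair; case: cid => p /= pP. Qed.

Lemma in_bigunion x z : z ∈ bigunion x <-> exists y, y ∈ x /\ z ∈ y.
Proof. by rewrite /bigunion; case: cid => p /= pP. Qed.

Lemma in_succ x z : z ∈ succ x <-> z ∈ x \/ z = x.
Proof.
rewrite in_bigunion; split=> [[y []]|[zx|->]].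
- by rewrite in_upair => -[->|->]; [left|rewrite in_upair; case; right].
- by exists x; rewrite in_upair; split=> //; left.
- by exists (upair x x); rewrite !in_upair; split; [right|left].
Qed.

Lemma zimage_ex (F : V -> V) x :
  exists y, forall z, z ∈ y <-> exists a, a ∈ x /\ F a = z.
Proof. by apply: zfc_replacement => a b c _ <- <-. Qed.

Definition zimage (F : V -> V) x : V := sval (cid (zimage_ex F x)).

Lemma in_zimage F x z : z ∈ zimage F x <-> exists a, a ∈ x /\ F a = z.
Proof. by rewrite /zimage; case: cid. Qed.

Lemma elts_inj x y : elts x = elts y -> x = y.
Proof.
by move=> e; apply: zfc_extensionality => z; rewrite -[z ∈ x]/(elts x z) e.
Qed.

Lemma elts_zsep x P : elts (zsep x P) = elts x `&` P.
Proof. by apply/seteqP; split=> z /in_zsep. Qed.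

Lemma subset_is_elts x P : P `<=` elts x -> exists y, elts y = P.
Proof. by move=> Px; exists (zsep x P); rewrite elts_zsep setIidr. Qed.

Lemma opair_inj x y x' y' : opair x y = opair x' y' -> x = x' /\ y = y'.
Proof.
move=> e.
have u (z a b c d : V) : upair a b = upair c d -> z = a \/ z = b -> z = c \/ z = d.
  by move=> h; rewrite -!in_upair h.
have ux (a b c : V) : upair a b = upair c c -> a = c /\ b = c.
  by move=> h; split; [case: (u a _ _ _ _ h); auto|case: (u b _ _ _ _ h); auto].
have exx : x = x'.
  have [h|h] := u _ _ _ _ _ e (or_introl (erefl (upair x x))).
    by have [] := ux _ _ _ h.
  by have [] := ux _ _ _ (esym h).
split=> //; subst x'.
have [h|h] := u _ _ _ _ _ e (or_intror (erefl (upair x y))).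
  have [_ yx] := ux _ _ _ h; subst y.
  have [h'|h'] := u _ _ _ _ _ (esym e) (or_intror (erefl (upair x y'))).
    by have [_ ->] := ux _ _ _ h'.
  by have [_ ->] := ux _ _ _ h'.
have [yx|//] := u y _ _ _ _ h (or_intror (erefl y)).
by subst y; have [_ ->] := ux _ _ _ (esym h).
Qed.

Lemma zempty_ex : exists x : V, forall z, ~ z ∈ x.
Proof. by have [w [[e []]]] := zfc_infinity V; exists e. Qed.

Definition zempty : V := sval (cid zempty_ex).

Lemma in_zempty z : ~ z ∈ zempty.
Proof. by rewrite /zempty; case: cid. Qed.

Lemma zmem_irr x : ~ x ∈ x.
Proof.
move=> xx; have [|y [/in_upair yx h]] := @zfc_foundation V (upair x x).
  by exists x; apply/in_upair; left.
have {yx} yx : y = x by case: yx.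
by apply: (h x); rewrite ?yx // in_upair; left.
Qed.

(** Distinctness of the numerals makes the relation between the n-th numeral and the n-th iterated
    union functional, as replacement requires in the proof of [zmem_wf]. *)
Lemma iter_succ_inj n m :
  iter n (@succ V) zempty = iter m (@succ V) zempty -> n = m.
Proof.
have lt i j : iter i (@succ V) zempty ∈ iter (i + j).+1 (@succ V) zempty.
  elim: j => [|j IH] /=; first by rewrite addn0 in_succ; right.
  by rewrite addnS in_succ; left.
move=> e; case: (ltngtP n m) => // h.
  by have := lt n (m - n.+1); rewrite -addSn subnKC // -e => /zmem_irr.
by have := lt m (n - m.+1); rewrite -addSn subnKC // e => /zmem_irr.
Qed.

(** Foundation speaks of sets only, so the inaccessible points are collected in a set [N] inside the
    transitive closure of the singleton of [a], which is the union of all [T n]. A minimal element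
    of [N] has only accessible elements, a contradiction. *)
Lemma zmem_wf : well_founded (fun x y : V => x ∈ y).
Proof.
move=> a; have [w [[e [e0 ew]] ws]] := zfc_infinity V.
have nw n : iter n (@succ V) zempty ∈ w.
  elim: n => [|n /ws[s [sw sP]]] /=.
    suff -> : zempty = e by [].
    by apply: elts_inj; apply/seteqP; split=> z; [move/in_zempty|move/e0].
  suff -> : succ (iter n (@succ V) zempty) = s by [].
  by apply: zfc_extensionality => z; rewrite sP in_succ.
pose T n := iter n (@bigunion V) (upair a a).
have [t tP] : exists t, forall z, z ∈ t <-> exists x, x ∈ w /\
    exists n, x = iter n (@succ V) zempty /\ z = T n.
  by apply: zfc_replacement => _ _ _ _ [n [-> ->]] [m [/iter_succ_inj -> ->]].
pose N := zsep (bigunion t) (fun x => ~ Acc (fun x y : V => x ∈ y) x).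
apply: contrapT => na.
have inN n x : x ∈ T n -> ~ Acc (fun x y : V => x ∈ y) x -> x ∈ N.
  move=> xn nx; apply/in_zsep; split=> //; apply/in_bigunion; exists (T n).
  by split=> //; apply/tP; exists (iter n (@succ V) zempty); split=> //; exists n.
have [|y [/in_zsep[/in_bigunion[u [/tP[_ [_ [n [_ ->]]]] yn]] ny] h]] :=
  @zfc_foundation V N.
  by exists a; apply: (inN 0%N) => //; apply/in_upair; left.
apply: ny; constructor => z zy; apply: contrapT => nz.
by apply: (h z) => //; apply: (inN n.+1) => //; apply/in_bigunion; exists y.
Qed.

Lemma zmem_ind (P : V -> Prop) :
  (forall x, (forall y, y ∈ x -> P y) -> P x) -> forall x, P x.
Proof. exact: (well_founded_ind zmem_wf). Qed.

(** * Ordinals *)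

Lemma ordinal_in a b : ordinal a -> b ∈ a -> ordinal b.
Proof.
by move=> [ta tb] ba; split; [exact: tb|move=> c cb; apply: tb; exact: (ta b)].
Qed.

Lemma ordinal_trans a b c : ordinal a -> b ∈ a -> c ∈ b -> c ∈ a.
Proof. by move=> [ta _] ba; apply: ta. Qed.

Lemma ordinal_min P a : ordinal a -> P a ->
  exists b, [/\ ordinal b, P b & forall c, c ∈ b -> ~ P c].
Proof.
elim/zmem_ind: a => a IH oa Pa.
have [[b [ba Pb]]|h] := pselect (exists b, b ∈ a /\ P b).
  by apply: (IH b) => //; exact: ordinal_in ba.
by exists a; split=> // c ca Pc; apply: h; exists c.
Qed.

Lemma ordinal_total a b : ordinal a -> ordinal b -> a ∈ b \/ a = b \/ b ∈ a.
Proof.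
elim/zmem_ind: a b => a IHa; elim/zmem_ind => b IHb oa ob.
have [ba|/existsNP[y /not_implyP[yb nya]]] := pselect (elts b `<=` elts a).
  have [ab|/existsNP[x /not_implyP[xa nxb]]] := pselect (elts a `<=` elts b).
    by right; left; apply: elts_inj; apply/seteqP; split.
  have [//|[xb|bx]] := IHa x xa b (ordinal_in oa xa) ob; right; right.
    by rewrite -xb.
  exact: ordinal_trans bx.
have [ay|[ay|//]] := IHb y yb oa (ordinal_in ob yb); left.
  exact: ordinal_trans ay.
by rewrite ay.
Qed.

Lemma ordinal_succ a : ordinal a -> ordinal (succ a).
Proof.
move=> oa; split=> y /in_succ; last first.
  by move=> [/(ordinal_in oa)[]|-> //]; case: oa.
by move=> ya z zy; apply/in_succ; left; case: ya zy => [/(ordinal_trans oa)|->]; auto.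
Qed.

Lemma ordinal_subset a b : ordinal a -> ordinal b ->
  (elts a `<=` elts b) <-> (a ∈ b \/ a = b).
Proof.
move=> oa ob; split=> [ab|[ab x|->//]]; last exact: ordinal_trans ab.
have [|[|ba]] := ordinal_total oa ob; [by left|by right|].
by have /zmem_irr := ab _ ba.
Qed.

Lemma ordinal_nsubset a b : ordinal a -> ordinal b ->
  ~ (elts a `<=` elts b) -> b ∈ a.
Proof.
move=> oa ob ab; have [h|[h|//]] := ordinal_total oa ob; case: ab.
  by apply/ordinal_subset => //; left.
by rewrite h.
Qed.

Lemma ordinal_max a b : ordinal a -> ordinal b ->
  exists c, [/\ (c = a \/ c = b), ordinal c, elts a `<=` elts c & elts b `<=` elts c].
Proof.
move=> oa ob; have [h|h] := pselect (elts a `<=` elts b).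
  by exists b; split=> //; right.
exists a; split=> //; first by left.
by apply/ordinal_subset => //; left; exact: ordinal_nsubset.
Qed.

Lemma ordinal_bigunion x : (forall a, a ∈ x -> ordinal a) -> ordinal (bigunion x).
Proof.
move=> ox; split=> [y /in_bigunion[a [ax ya]] z zy|y /in_bigunion[a [ax ya]]].
  by apply/in_bigunion; exists a; split=> //; exact: ordinal_trans (ox _ ax) ya zy.
by have [_] := ox a ax; apply.
Qed.

(** Burali-Forti: if the successor of the union [o] of the ordinals in [x] were in [x], then [o]
    would be an element of itself. *)
Lemma ordinals_not_set x : exists a, ordinal a /\ ~ a ∈ x.
Proof.
pose o := bigunion (zsep x (@ordinal V)).
have oo : ordinal o by apply: ordinal_bigunion => a /in_zsep[].
exists (succ o); split; first exact: ordinal_succ.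
move=> ox; apply: (@zmem_irr o); apply/in_bigunion; exists (succ o).
by rewrite in_succ; split; [apply/in_zsep; split=> //; exact: ordinal_succ|right].
Qed.

(** * Cardinals *)

Lemma cardinal_ordinal k : cardinal k -> ordinal k.
Proof. by case. Qed.

Lemma in_cardinal k a : cardinal k -> a ∈ k -> elts a #< elts k.
Proof.
move=> [ok kc] ak; apply/andP; split; last exact: kc.
by apply: subset_card_le => z; exact: ordinal_trans ak.
Qed.

Lemma cardinalI k : ordinal k -> (forall a, a ∈ k -> ~ (elts k #<= elts a)) ->
  cardinal k.
Proof. by move=> ok kP; split=> // a /kP/negP. Qed.

Lemma lt_in_cardinal k a : ordinal a -> cardinal k -> elts a #< elts k -> a ∈ k.
Proof.
move=> oa [ok kc] /card_ltNge h; apply: ordinal_nsubset => // ka.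
exact/h/subset_card_le.
Qed.

(** If no ordinal dominated [x], the greedy embedding would inject all ordinals into [x], and
    replacement would collect them in a set [Y]. The least ordinal dominating [x] embeds back
    greedily, since its elements do not dominate [x]. *)
Lemma equinumerous_cardinal x : exists k, cardinal k /\ elts x #= elts k.
Proof.
have [a [oa xa]] : exists a, ordinal a /\ elts x #<= elts a.
  apply: contrapT => h.
  have : (@ordinal V : set V) #<= elts x.
    apply: (card_le_greedy zempty zmem_wf) => [a b oa ob|a oa xa].
      exact: ordinal_total.
    apply: h; exists a; split=> //; apply: card_le_trans xa _.
    by apply: subset_card_le => y [].
  move=> /(card_leE zempty)[F [Fx Finj]].
  have [Y YP] : exists Y, forall b, b ∈ Y <-> exists z, z ∈ x /\ (ordinal b /\ F b = z).
    apply: zfc_replacement => z b c _ [ob <-] [oc e]; exact: (Finj _ _ ob oc (esym e)).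
  have [b [ob nb]] := ordinals_not_set Y.
  by apply/nb/YP; exists (F b); split=> //; exact: Fx.
have [k [ok xk kmin]] := ordinal_min (P := fun a => elts x #<= elts a) oa xa.
have kx : elts k #<= elts x.
  apply: (card_le_greedy zempty zmem_wf) => [b c bk ck|b bk xb].
    by apply: ordinal_total; exact: ordinal_in ok _.
  by apply: (kmin b bk); apply: card_le_trans xb (subset_card_le _) => y [].
exists k; split; last by apply/card_eqPle; split.
by apply: cardinalI => // c ck kc; apply: (kmin c ck); exact: card_le_trans kc.
Qed.

Lemma card_total x y : elts x #<= elts y \/ elts y #< elts x.
Proof.
have [a [ca xa]] := equinumerous_cardinal x.
have [b [cb yb]] := equinumerous_cardinal y.
have lea (u v : V) : cardinal u -> cardinal v -> u ∈ v \/ elts v #<= elts u.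
  move=> cu cv; have [uv|[->|vu]] :=
    ordinal_total (cardinal_ordinal cu) (cardinal_ordinal cv); first by left.
    by right.
  by right; exact/card_ltW/in_cardinal.
have [ba|ab] := lea b a cb ca.
  right; apply: card_le_lt_trans (card_eqW yb) _.
  exact: card_lt_le_trans (in_cardinal ca ba) (card_eq_ge xa).
left; apply: card_le_trans (card_eqW xa) _.
exact: card_le_trans ab (card_eq_ge yb).
Qed.

Lemma card_nle_lt x y : ~ (elts x #<= elts y) -> elts y #< elts x.
Proof. by have [|//] := card_total x y. Qed.

(** The least ordinal that does not embed in [x] works; Cantor's argument for the power set shows
    that there is one. *)
Lemma cardinal_succ x : exists k, [/\ cardinal k, elts x #< elts k &
  forall a, a ∈ k -> elts a #<= elts x].
Proof.
have [p [cp xp]] := equinumerous_cardinal (zpow x).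
have npx : ~ (elts p #<= elts x).
  move=> px; have /card_leE_surj[] := card_le_trans (card_eqW xp) px.
    by exists x; apply/in_zpow.
  move=> f [_ fsurj]; have [X [Xx XP]] := cantor (elts x) (fun z => elts (f z)).
  have [y yX] := subset_is_elts Xx.
  have [z [zx fz]] : exists z, elts x z /\ f z = y.
    by apply: fsurj; apply/in_zpow; rewrite yX.
  by apply: (XP z zx); rewrite fz.
have [k [ok kx kmin]] :=
  ordinal_min (P := fun a => ~ (elts a #<= elts x)) (cardinal_ordinal cp) npx.
exists k; split=> [||a /kmin/contrapT//]; last exact: card_nle_lt.
apply: cardinalI => // a /kmin/contrapT ax ka.
by apply: kx; exact: card_le_trans ax.
Qed.

End Sets.

(** * Arithmetic of infinite cardinals *)

Lemma infinite_setU1_le (T : Type) (A : set T) (x : T) :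
  infinite_set A -> [set y | A y \/ y = x] #<= A.
Proof.
have [Ax|nAx] := pselect (A x).
  by move=> _; apply: subset_card_le => y [//|->].
move=> /infiniteP iA; have [g [gA ginj]] := card_leE x iA.
(* Hilbert's hotel: [x] moves to [g 0], each [g n] to [g n.+1], and all other points stay. *)
pose f y := if pselect (y = x) then g 0%N else
  if pselect (exists n, y = g n) is left e then g (sval (cid e)).+1 else y.
have fx : f x = g 0%N by rewrite /f; case: (pselect (x = x)).
have fg n : f (g n) = g n.+1.
  rewrite /f; case: (pselect (g n = x)) => [gx|ngx]; first by case: nAx; rewrite -gx; exact: gA.
  case: pselect => [e|]; last by case; exists n.
  by case: (cid e) => m /= /ginj ->.
have fy y : y <> x -> (forall n, y <> g n) -> f y = y.
  move=> yx yg; rewrite /f; case: (pselect (y = x)) => // yx0; case: pselect => // e; case: (cid e) => n /= e2.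
  by case: (yg n).
have cases y : [\/ y = x, exists n, y = g n | y <> x /\ forall n, y <> g n].
  have [->|yx] := pselect (y = x); first by constructor 1.
  have [h|h] := pselect (exists n, y = g n); first by constructor 2.
  by constructor 3; split=> // n yn; apply: h; exists n.
apply: (@card_le_inj _ _ _ _ f) => [y [Ay|->]|y z Ay Az].
- by have [->|[n ->]|[yx yg]] := cases y; rewrite ?fx ?fg ?fy //; exact: gA.
- by rewrite fx; exact: gA.
have [->|[n ->]|[yx yg]] := cases y; have [->|[m ->]|[zx zg]] := cases z;
  rewrite ?fx ?fg ?(fy y) ?(fy z) //.
- by move=> /(ginj _ _ I I).
- by move=> /esym/zg.
- by move=> /(ginj _ _ I I).
- by move=> /(ginj _ _ I I)[->].
- by move=> /esym/zg.
- by move=> /yg.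
- by move=> /yg.
Qed.

Section Arithmetic.
Context {V : zfc}.
Implicit Types (x y z k a : V).

Lemma infinite_cardinal_succ k a : cardinal k -> infinite_set (elts k) ->
  a ∈ k -> elts (succ a) #< elts k.
Proof.
move=> ck ik ak; apply: card_nle_lt => ka.
have sa : elts (succ a) = [set y | elts a y \/ y = a].
  by apply/seteqP; split=> y /in_succ.
have [fa|ia] := pselect (finite_set (elts a)).
  apply: ik; apply: card_le_finite ka _; rewrite sa.
  have -> : [set y | elts a y \/ y = a] = elts a `|` [set a] by [].
  by rewrite finite_setU; split.
apply: (card_ltNge (in_cardinal ck ak)); apply: card_le_trans ka _.
by rewrite sa; exact: infinite_setU1_le.
Qed.

Definition pair_max (p : V * V) : V := if pselect (p.1 ∈ p.2) then p.2 else p.1.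

(** Gödel's order on pairs of ordinals: by the maximum, then lexicographically. What precedes [p]
    lies in the square of [succ (pair_max p)]. *)
Definition pair_lt (p q : V * V) : Prop := pair_max p ∈ pair_max q \/
  (pair_max p = pair_max q /\ (p.1 ∈ q.1 \/ (p.1 = q.1 /\ p.2 ∈ q.2))).

Lemma pair_lt_wf : well_founded pair_lt.
Proof.
suff h m a b : pair_max (a, b) = m -> Acc pair_lt (a, b).
  by case=> a b; exact: h.
elim/(@zmem_ind V): m a b => m IHm; elim/(@zmem_ind V) => a IHa; elim/(@zmem_ind V) => b IHb abm.
constructor => -[c d]; rewrite /pair_lt abm /= => -[h|[h [ca|[ca db]]]].
- exact: IHm h _ _ erefl.
- exact: IHa ca _ h.
- by rewrite ca in h *; exact: IHb.
Qed.

(** The predecessors of a pair in Gödel's order embed in the square of some cardinal [c] below [k].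
    This square is finite or, by induction, of size at most [c], so the predecessors never exhaust
    [k] and the greedy embedding applies. *)
Lemma card_square k : cardinal k -> infinite_set (elts k) ->
  elts k `*` elts k #<= elts k.
Proof.
elim/(@zmem_ind V): k => k IH ck ik; have ok := cardinal_ordinal ck.
have mxk p : (elts k `*` elts k) p -> [/\ pair_max p ∈ k,
    p.1 ∈ succ (pair_max p) & p.2 ∈ succ (pair_max p)].
  move=> [p1k p2k]; rewrite /pair_max; case: pselect => h; split=> //.
  - by apply/in_succ; left.
  - by apply/in_succ; right.
  - by apply/in_succ; right.
  - apply/in_succ; have [//|[e|p21]] := ordinal_total (ordinal_in ok p1k)
      (ordinal_in ok p2k); [by right|by left].
apply: (card_le_greedy zempty pair_lt_wf) => [p q Pp Pq|p Pp kp].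
  have [pk _ _] := mxk p Pp; have [qk _ _] := mxk q Pq.
  have [p1 p2] := Pp; have [q1 q2] := Pq.
  have [h|[h|h]] := ordinal_total (ordinal_in ok pk) (ordinal_in ok qk).
  - by left; left.
  - have [h1|[h1|h1]] := ordinal_total (ordinal_in ok p1) (ordinal_in ok q1).
    + by left; right; split=> //; left.
    + have [h2|[h2|h2]] := ordinal_total (ordinal_in ok p2) (ordinal_in ok q2).
      * by left; right; split=> //; right.
      * by right; left; case: p q h1 h2 {Pp Pq pk qk p1 p2 q1 q2 h} => ? ? [? ?] /= -> ->.
      * by right; right; right; split=> //; right.
    + by right; right; right; split=> //; left.
  - by right; right; left.
have [mk _ _] := mxk p Pp.
have [c [cc sc]] := equinumerous_cardinal (succ (pair_max p)).
have clt : elts c #< elts k.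
  exact: card_le_lt_trans (card_eq_ge sc) (infinite_cardinal_succ ck ik mk).
have ckin : c ∈ k := lt_in_cardinal (cardinal_ordinal cc) ck clt.
have om := ordinal_in ok mk.
have kcc : elts k #<= elts c `*` elts c.
  apply: card_le_trans kp _.
  have [f [fc finj]] := card_leE zempty (card_eqW sc).
  have sub q : (elts k `*` elts k) q -> pair_lt q p ->
      q.1 ∈ succ (pair_max p) /\ q.2 ∈ succ (pair_max p).
    move=> Pq qp; have [qk q1 q2] := mxk q Pq.
    have qp' : elts (succ (pair_max q)) `<=` elts (succ (pair_max p)).
      move=> z /in_succ zq; apply/in_succ; case: qp => [qp|[<- _] //].
      by left; case: zq => [zq|->//]; exact: ordinal_trans zq.
    by split; apply: qp'.
  apply: (@card_le_inj _ _ _ _ (fun q => (f q.1, f q.2))) => [q [Pq qp]|].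
    by have [q1 q2] := sub q Pq qp; split; apply: fc.
  move=> [a b] [a' b'] [Pq qp] [Pq' qp'] [/= e1 e2].
  have [/= q1 q2] := sub _ Pq qp; have [/= q1' q2'] := sub _ Pq' qp'.
  by rewrite (finj _ _ q1 q1' e1) (finj _ _ q2 q2' e2).
have [fc|ic] := pselect (finite_set (elts c)).
  by apply: ik; apply: card_le_finite kcc (finite_setX fc fc).
by apply: (card_ltNge clt); apply: card_le_trans kcc (IH c ckin cc ic).
Qed.

Lemma card_square_le x : infinite_set (elts x) -> elts x `*` elts x #<= elts x.
Proof.
move=> ix; have [k [ck xk]] := equinumerous_cardinal x.
have ik : infinite_set (elts k) := infinite_le (card_eqW xk) ix.
apply: card_le_trans (card_le_trans (card_square ck ik) (card_eq_ge xk)).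
have [f [fc finj]] := card_leE zempty (card_eqW xk).
apply: (@card_le_inj _ _ _ _ (fun q => (f q.1, f q.2))) => [q [q1 q2]|].
  by split; exact: fc.
by move=> [a b] [a' b'] [/= ? ?] [/= ? ?] [/finj-> // /finj-> //].
Qed.

Lemma bigcup_card_le (I T : Type) (D : set I) (F : I -> set T) x :
  infinite_set (elts x) -> D #<= elts x -> (forall i, D i -> F i #<= elts x) ->
  \bigcup_(i in D) F i #<= elts x.
Proof.
move=> ix Dx Fx; have [[i0 Di0]|D0] := pselect (D !=set0); last first.
  suff -> : \bigcup_(i in D) F i = set0 by exact: card_ge0.
  by apply/seteqP; split=> // t [i Di]; case: D0; exists i.
have [[t0 _]|F0] := pselect ((\bigcup_(i in D) F i) !=set0); last first.
  suff -> : \bigcup_(i in D) F i = set0 by exact: card_ge0.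
  by apply/seteqP; split=> // t ?; case: F0; exists t.
have [d [_ dsurj]] := card_leE_surj (ex_intro _ i0 Di0) Dx.
have fex i : exists f : V -> T, D i -> forall t, F i t -> exists y, elts x y /\ f y = t.
  have [Di|nDi] := pselect (D i); last by exists (fun=> t0) => /nDi.
  have [[t Ft]|F0] := pselect (F i !=set0); last first.
    by exists (fun=> t0) => _ t Ft; case: F0; exists t.
  have [f [_ fP]] := card_leE_surj (ex_intro _ t Ft) (Fx i Di).
  by exists f.
have [f fP] := choice fex.
apply: card_le_trans (card_square_le ix).
apply: (@card_le_surj _ _ _ _ (fun q => f (d q.1) q.2)) => t [i Di Fit].
have [y [xy dy]] := dsurj i Di; have [z [xz fz]] := fP _ Di t Fit.
by exists (y, z); split; rewrite /= ?dy.
Qed.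

Lemma setU_bigcup_bool (T : Type) (A B : set T) :
  A `|` B = \bigcup_(b in [set: bool]) (if b then A else B).
Proof.
apply/seteqP; split=> t; first by case=> h; [exists true|exists false].
by case=> -[] _ h; [left|right].
Qed.

Lemma setU_card_le (T : Type) (A B : set T) x : infinite_set (elts x) ->
  A #<= elts x -> B #<= elts x -> A `|` B #<= elts x.
Proof.
move=> ix Ax Bx.
rewrite setU_bigcup_bool.
apply: bigcup_card_le => // [|[] //].
by apply/card_ltW/finite_lt_infinite => //; exact: finite_finset.
Qed.

End Arithmetic.

(** * Regular cardinals *)

Section Regular.
Context {V : zfc}.
Implicit Types (x y z k a b l m : V).

Lemma equinumerous_elts (T : Type) (A : set T) x : A #<= elts x ->
  exists y, elts y `<=` elts x /\ A #= elts y.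
Proof.
move=> /(card_leE zempty)[f [fx finj]].
have [|y yE] := @subset_is_elts V x (f @` A); first by move=> _ [t /fx ? <-].
exists y; rewrite yE; split; first by move=> _ [t /fx ? <-].
rewrite card_eq_sym; apply: inj_card_eq => t u /set_mem At /set_mem Au.
exact: finj.
Qed.

Lemma lt_cardinal (T : Type) (A : set T) k : cardinal k -> A #< elts k ->
  exists a, [/\ cardinal a, a ∈ k & A #= elts a].
Proof.
move=> ck Ak; have [y [_ Ay]] := equinumerous_elts (card_ltW Ak).
have [a [ca ya]] := equinumerous_cardinal y.
exists a; split=> //; last exact: card_eq_trans Ay ya.
apply: lt_in_cardinal => //; first exact: cardinal_ordinal.
apply: card_le_lt_trans (card_eq_ge ya) _.
exact: card_le_lt_trans (card_eq_ge Ay) Ak.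
Qed.

(** Through [x] the class [A] is represented by a set, and sets are comparable in size. *)
Lemma nlt_ge (T : Type) (A : set T) x y : A #<= elts x ->
  ~ (A #< elts y) -> elts y #<= A.
Proof.
move=> /equinumerous_elts[a [_ Aa]] Ay.
have [ya|ay] := card_total y a; first exact: card_le_trans ya (card_eq_ge Aa).
by case: Ay; exact: card_le_lt_trans (card_eqW Aa) ay.
Qed.

(** Since the bound [m] is uniform, the size of the union is at most the maximum [c] of [m] and the
    size of [D] if [c] is infinite, and the union is finite otherwise. *)
Lemma bigcup_card_lt (I T : Type) (D : set I) (F : I -> set T) k m :
  cardinal k -> infinite_set (elts k) -> D #< elts k -> m ∈ k ->
  (forall i, D i -> F i #<= elts m) -> \bigcup_(i in D) F i #< elts k.
Proof.
move=> ck ik Dk mk Fm; have [a [ca ak Da]] := lt_cardinal ck Dk.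
have om := ordinal_in (cardinal_ordinal ck) mk.
have [c [cE oc ac mc]] := ordinal_max (cardinal_ordinal ca) om.
have cink : c ∈ k by case: cE => ->.
have Dc : D #<= elts c := card_le_trans (card_eqW Da) (subset_card_le ac).
have Fc i : D i -> F i #<= elts c.
  by move=> /Fm Fi; exact: card_le_trans Fi (subset_card_le mc).
have [fc|ic] := pselect (finite_set (elts c)).
  apply: finite_lt_infinite => //; apply: bigcup_finite.
    exact: card_le_finite Dc fc.
  by move=> i /Fc Fi; exact: card_le_finite Fi fc.
exact: card_le_lt_trans (bigcup_card_le ic Dc Fc) (in_cardinal ck cink).
Qed.

Lemma setU_card_lt (T : Type) (A B : set T) k : cardinal k ->
  infinite_set (elts k) -> A #< elts k -> B #< elts k -> A `|` B #< elts k.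
Proof.
move=> ck ik Ak Bk; have [a [ca ak Aa]] := lt_cardinal ck Ak.
have [b [cb bk Bb]] := lt_cardinal ck Bk.
have [c [cE oc ac bc]] := ordinal_max (cardinal_ordinal ca) (cardinal_ordinal cb).
rewrite setU_bigcup_bool.
apply: (@bigcup_card_lt _ _ _ _ _ c) => //; last first.
- by move=> [] _; [apply: card_le_trans (card_eqW Aa) _|
                   apply: card_le_trans (card_eqW Bb) _]; exact: subset_card_le.
- by case: cE => ->.
- by apply: finite_lt_infinite => //; exact: finite_finset.
Qed.

Lemma is_cf_unique l m m' : is_cf l m -> is_cf l m' -> m = m'.
Proof.
move=> [om cm nm] [om' cm' nm'].
have [h|[//|h]] := ordinal_total om om'; first by case: (nm' m h).
by case: (nm m' h).
Qed.

Lemma cofinal_id l : cofinal_map l l id.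
Proof. by split=> // a al; exists a; split=> //; right. Qed.

Lemma is_cf_le l m : ordinal l -> is_cf l m -> m = l \/ m ∈ l.
Proof.
move=> ol [om _ nm]; have [h|[|h]] := ordinal_total om ol; [by right|by left|].
by case: (nm l h); exists id; exact: cofinal_id.
Qed.

(** Enumerating [A] by a cardinal [n] below [l] turns [f] into a map on [n], which is not cofinal; a
    point of [l] that it does not reach is a strict bound. *)
Lemma regular_bound (T : Type) (A : set T) (f : T -> V) l :
  cardinal l -> elts l !=set0 -> is_cf l l -> A #< elts l ->
  (forall t, A t -> f t ∈ l) -> exists b, b ∈ l /\ forall t, A t -> f t ∈ b.
Proof.
move=> cl [b0 b0l] [ol _ nl] Al fl; have [n [cn nL An]] := lt_cardinal cl Al.
have [A0|A0] := pselect (A !=set0); last first.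
  by exists b0; split=> // t At; case: A0; exists t.
have [g [gA gsurj]] := card_leE_surj A0 (card_eqW An).
have /not_andP[h|/existsNP[a /not_implyP[al nal]]] :
    ~ cofinal_map l n (f \o g) by move=> h; apply: (nl n nL); exists (f \o g).
  by case: h => x /gA/fl.
exists a; split=> // t /gsurj[x [xn <-]].
have [h|[h|//]] := ordinal_total (ordinal_in ol al)
  (ordinal_in ol (fl _ (gA _ xn))).
  by case: nal; exists x; split=> //; left.
by case: nal; exists x; split=> //; right.
Qed.

(** A cofinal map on a smaller ordinal would write [k] as a union of at most |x| sets, each of size
    at most |x|. *)
Lemma regular_succ x : infinite_set (elts x) -> exists k,
  [/\ regular k, elts x #< elts k & forall a, a ∈ k -> elts a #<= elts x].
Proof.
move=> ix; have [k [ck xk kx]] := cardinal_succ x; exists k; split=> //.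
have ok := cardinal_ordinal ck.
have ik := infinite_le (card_ltW xk) ix.
split=> //; split=> // [|n nk [f [fk fcof]]]; first by exists id; exact: cofinal_id.
apply: (card_ltNge xk).
apply: (@card_le_trans _ _ _ (\bigcup_(i in elts n) elts (succ (f i)))).
  apply: subset_card_le => a /fcof[i [ni ai]]; exists i => //.
  by apply/in_succ; case: ai; auto.
apply: bigcup_card_le => // [|i /fk fi]; first exact: kx.
have [ks|sk] := pselect (succ (f i) ∈ k); first exact: kx.
case: sk; apply: lt_in_cardinal => //.
  exact/ordinal_succ/(ordinal_in ok fi).
exact: infinite_cardinal_succ.
Qed.

(** * Hereditarily small sets *)

Lemma H_large x : exists a, ordinal a /\
  forall theta, elts a `<=` elts theta -> H theta x.
Proof.
elim/(@zmem_ind V): x => x IH.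
have /choice[f fP] : forall y, exists a, y ∈ x ->
    ordinal a /\ forall theta, elts a `<=` elts theta -> H theta y.
  by move=> y; have [/IH[a aP]|] := pselect (y ∈ x); [exists a|exists x].
have [k [ck xk _]] := cardinal_succ x.
have of_ : ordinal (bigunion (zimage f x)).
  by apply: ordinal_bigunion => a /in_zimage[y [/fP[? _] <-]].
(* [c] is at least the bound of every element of [x], and at least a cardinal larger than [x]. *)
have [c [_ oc uc kc]] := ordinal_max of_ (cardinal_ordinal ck).
exists c; split; first exact: oc.
move=> theta ct; constructor.
  exact: card_lt_le_trans xk (subset_card_le (subset_trans kc ct)).
move=> y yx; have [_] := fP y yx; apply=> z zf; apply/ct/uc/in_bigunion.
by exists (f y); split=> //; apply/in_zimage; exists y.
Qed.

Lemma H_regular x l : ordinal l -> infinite_set (elts l) ->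
  exists theta, [/\ regular theta, l ∈ theta & H theta x].
Proof.
move=> ol il; have [a [oa aH]] := H_large x.
have [c [_ oc ac lc]] := ordinal_max oa ol.
have ic : infinite_set (elts c) := infinite_le (subset_card_le lc) il.
have [theta [rt ct _]] := regular_succ ic.
have [ctheta _ _] := rt.
have cint := lt_in_cardinal oc ctheta ct.
have sub : elts c `<=` elts theta.
  by move=> z; exact: ordinal_trans (cardinal_ordinal ctheta) cint.
exists theta; split; first exact: rt.
  by have [/sub//|->] := (ordinal_subset ol oc).1 lc.
exact/aH/(subset_trans ac).
Qed.

Lemma H_inv theta x : H theta x ->
  elts x #< elts theta /\ forall y, y ∈ x -> H theta y.
Proof. by case. Qed.

Lemma H_in theta x y : H theta x -> y ∈ x -> H theta y.
Proof. by move=> /H_inv[_ h] yx; exact: h. Qed.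

Lemma H_upair theta x y : infinite_set (elts theta) ->
  H theta x -> H theta y -> H theta (upair x y).
Proof.
move=> it Hx Hy; constructor; last by move=> z /in_upair[]->; [exact: Hx|exact: Hy].
apply: finite_lt_infinite => //.
suff -> : elts (upair x y) = [set x; y] by exact: finite_set2.
by apply/seteqP; split=> z /in_upair.
Qed.

Lemma H_subset theta x y : elts y `<=` elts x -> H theta x -> H theta y.
Proof.
move=> yx /H_inv[xt xH]; constructor; last by move=> z /yx/xH h; exact: h.
exact: card_le_lt_trans (subset_card_le yx) xt.
Qed.

End Regular.

(** * Definability in elementary submodels *)

Section Formulas.
Context {V : zfc} (D : set V).
Implicit Types (x y z s W : V) (e : nat -> V) (p q : formula).
Hypothesis Dtrans : forall x y, D x -> y ∈ x -> D y.
Hypothesis Dupair : forall x y, D x -> D y -> D (upair x y).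

Definition f_all p := FNot (FEx (FNot p)).
Definition f_iff p q := FAnd (FNot (FAnd p (FNot q))) (FNot (FAnd q (FNot p))).
Definition f_or p q := FNot (FAnd (FNot p) (FNot q)).

Lemma sat_all e p : sat D e (f_all p) <-> forall x, D x -> sat D (scons x e) p.
Proof.
split=> [h x Dx|h [x [Dx]]]; last by apply; exact: h.
by apply: contrapT => nx; apply: h; exists x.
Qed.

Lemma sat_iff e p q : sat D e (f_iff p q) <-> (sat D e p <-> sat D e q).
Proof.
rewrite /f_iff /=; split=> [[h1 h2]|[h1 h2]].
  by split=> h; apply: contrapT => nh; [apply: h1|apply: h2].
by split=> -[h]; apply; auto.
Qed.

Lemma sat_or e p q : sat D e (f_or p q) <-> (sat D e p \/ sat D e q).
Proof.
rewrite /f_or /=; split=> [h|[h|h] []//].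
by apply: contrapT => /not_orP.
Qed.

(** Index 0 is the bound variable, hence the shift of the other indices. *)
Definition f_upair i j k :=
  f_all (f_iff (FMem 0 i.+1) (f_or (FEq 0 j.+1) (FEq 0 k.+1))).

Lemma sat_upair e i j k : D (e i) -> D (e j) -> D (e k) ->
  sat D e (f_upair i j k) <-> e i = upair (e j) (e k).
Proof.
move=> Di Dj Dk; rewrite sat_all; split=> [h|h x Dx]; last first.
  by rewrite sat_iff sat_or /= h in_upair.
apply: zfc_extensionality => z; rewrite in_upair; split=> hz.
  by have := h z (Dtrans Di hz); rewrite sat_iff sat_or /= => -[h1 _]; exact: h1.
have Dz : D z by case: hz => ->.
by have := h z Dz; rewrite sat_iff sat_or /= => -[_ h1]; exact: h1.
Qed.

(** Kuratowski's pair: index 1 is the singleton, index 0 the unordered pair. *)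
Definition f_opair i j k :=
  FEx (FEx (FAnd (f_upair 1 j.+2 j.+2)
    (FAnd (f_upair 0 j.+2 k.+2) (f_upair i.+2 1 0)))).

Lemma sat_opair e i j k : D (e i) -> D (e j) -> D (e k) ->
  sat D e (f_opair i j k) <-> e i = opair (e j) (e k).
Proof.
move=> Di Dj Dk; split=> [[u [Du [v [Dv [h1 [h2 h3]]]]]]|h].
  move: h1 h2 h3 => /sat_upair h1 /sat_upair h2 /sat_upair h3.
  move: h1 h2 h3 => /= h1 h2 h3.
  by rewrite (h3 Di Du Dv) (h1 Du Dj Dj) (h2 Dv Dj Dk).
exists (upair (e j) (e j)); split; first exact: Dupair.
exists (upair (e j) (e k)); split; first exact: Dupair.
by split; [|split]; apply/sat_upair => //=; exact: Dupair.
Qed.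

Lemma D_opair x y : D (opair x y) <-> D x /\ D y.
Proof.
split=> [h|[Dx Dy]]; last by do !apply: Dupair.
have h' : D (upair x y) by apply: (Dtrans h); rewrite in_upair; right.
by split; apply: (Dtrans h'); rewrite in_upair; [left|right].
Qed.

Section Submodel.
Variable M : set V.
Hypothesis MD : elementary_submodel M D.

Lemma sub_D x : M x -> D x.
Proof. by case: MD => _ + _; apply. Qed.

(** As the formula is evaluated in [D] on both sides, an object that it defines uniquely in [D] from
    parameters in [M] lies in [M]. The closure properties of [M] below all come from this. *)
Lemma tarski_vaught p e : (forall n, M (e n)) ->
  (exists y, D y /\ sat D (scons y e) p) -> exists y, M y /\ sat D (scons y e) p.
Proof.
move=> Me h; have [_ _ el] := MD.
have [y [My yp]] : sat M e (FEx p) by apply/(el (FEx p) e Me).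
by exists y; split=> //; apply/(el p (scons y e)) => // -[|n] /=.
Qed.

Lemma sub_opair x y : M x -> M y -> M (opair x y).
Proof.
move=> Mx My; have [Dx Dy] := (sub_D Mx, sub_D My).
have [||z [Mz /sat_opair /= h]] :=
    @tarski_vaught (f_opair 0 1 2) (scons x (scons y (fun=> x))).
- by move=> [|[|n]].
- exists (opair x y); have Dxy : D (opair x y) by exact/D_opair.
  by split=> //; apply/sat_opair.
by rewrite -h //; exact: sub_D.
Qed.

Lemma sub_opairI x y : M (opair x y) -> M x /\ M y.
Proof.
move=> Mp; have Dp := sub_D Mp; have [Dx Dy] := (D_opair x y).1 Dp; split.
- have [//||z [Mz [w [Dw /sat_opair /= h]]]] :=
    @tarski_vaught (FEx (f_opair 2 1 0)) (fun=> opair x y).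
  + by exists x; split=> //; exists y; split=> //; apply/sat_opair.
  + by have /opair_inj[-> _] := h Dp (sub_D Mz) Dw.
- have [//||z [Mz [w [Dw /sat_opair /= h]]]] :=
    @tarski_vaught (FEx (f_opair 2 0 1)) (fun=> opair x y).
  + by exists y; split=> //; exists x; split=> //; apply/sat_opair.
  + by have /opair_inj[_ ->] := h Dp Dw (sub_D Mz).
Qed.

Lemma sub_apply f x y : M f -> M x -> opair x y ∈ f ->
  (forall y', opair x y' ∈ f -> y' = y) -> M y.
Proof.
move=> Mf Mx fxy fun_; have [Df Dx] := (sub_D Mf, sub_D Mx).
have Dxy := Dtrans Df fxy; have [_ Dy] := (D_opair x y).1 Dxy.
(* Indices 0 to 3 are the pair, its second coordinate, [x] and [f]. *)
have [||z [Mz [w [Dw [wf /sat_opair wE]]]]] := @tarski_vaught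
    (FEx (FAnd (FMem 0 3) (f_opair 0 2 1))) (scons x (fun=> f)).
- by move=> [|n].
- exists y; split=> //; exists (opair x y); split=> //; split=> //.
  exact/sat_opair.
by move: wf wE => /= wf wE; rewrite -(fun_ z) // -wE //; exact: sub_D.
Qed.

Hypothesis Dsub : forall x y, elts y `<=` elts x -> D x -> D y.

(** For a sequence [s] this is the trace on [W] of the union of its values. Being a subset of [W],
    it stays in a class closed under subsets. *)
Definition union_of_values s W : V :=
  zsep W [set z | exists x y, opair x y ∈ s /\ z ∈ y].

Lemma sub_union_of_values s W : M s -> M W -> M (union_of_values s W).
Proof.
move=> Ms MW; have [Ds DW] := (sub_D Ms, sub_D MW).
(* Indices 0 to 3 are an element, the candidate set, [s] and [W]; under the three inner quantifiers
   the element is 3 and [s] is 5. *)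
pose p := f_iff (FMem 0 1) (FAnd (FMem 0 3) (FEx (FEx (FEx
  (FAnd (FMem 2 5) (FAnd (f_opair 2 1 0) (FMem 3 0))))))).
have DU : D (union_of_values s W) by apply: Dsub DW => z /in_zsep[].
have pP X z : D X -> D z ->
    sat D (scons z (scons X (scons s (fun=> W)))) p <->
    (z ∈ X <-> z ∈ union_of_values s W).
  move=> DX Dz; rewrite sat_iff in_zsep.
  suff h : sat D (scons z (scons X (scons s (fun=> W)))) (FEx (FEx (FEx
      (FAnd (FMem 2 5) (FAnd (f_opair 2 1 0) (FMem 3 0)))))) <->
      exists x y, opair x y ∈ s /\ z ∈ y.
    split=> -[h1 h2]; split.
    - by move=> /h1[zW zU]; split=> //; apply/h.
    - by move=> [zW zU]; apply: h2; split=> //; apply/h.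
    - by move=> /h1[zW zU]; split=> //; apply/h.
    - by move=> [zW zU]; apply: h2; split=> //; apply/h.
  split=> [[q [Dq [x [Dx [y [Dy [qs [/sat_opair h zy]]]]]]]]|[x [y [xys zy]]]].
    by exists x, y; split=> //; rewrite -[opair x y]h.
  have Dxy := Dtrans Ds xys; have [Dx Dy] := (D_opair x y).1 Dxy.
  exists (opair x y); split=> //; exists x; split=> //; exists y; split=> //.
  by split=> //; split=> //; apply/sat_opair.
have [||X [MX /sat_all hX]] := @tarski_vaught (f_all p) (scons s (fun=> W)).
- by move=> [|n].
- exists (union_of_values s W); split=> //; apply/sat_all => z Dz.
  by apply/(pP _ z).
suff <- : X = union_of_values s W by [].
have DX := sub_D MX.
apply: zfc_extensionality => z; split=> h.
  have Dz := Dtrans DX h.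
  by have /(pP X z DX Dz)[h1 _] := hX z Dz; exact: h1.
have Dz := Dtrans DU h.
by have /(pP X z DX Dz)[_ h1] := hX z Dz; exact: h1.
Qed.

End Submodel.
End Formulas.

(** * Chains of submodels *)

Section Chains.
Context {V : zfc}.
Implicit Types (x y z a b l m nu P W : V) (M : V -> V) (C : V -> set V).

(* What remains of elementarity in a chain given by CECA(l) is the last clause,
   about an arbitrary family C of sets with parameters in P. *)
Definition good_chain C P W l nu M : Prop :=
  [/\ ordinal nu, is_cf l nu, forall x y, x ∈ y -> y ∈ nu -> elts (M x) `<=` elts (M y) &
      continuous_chain nu M] /\
  [/\ forall x, x ∈ nu -> weakly_closed (M x),
      forall x, x ∈ nu -> elts (M x) #< elts l,
      elts W `<=` \bigcup_(x in elts nu) elts (M x),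
      forall x, x ∈ nu -> succ x ∈ nu &
      forall m, m ∈ l -> exists a, a ∈ nu /\ forall b, b ∈ nu -> a ∈ b ->
        forall x, x ∈ M b -> x ∈ P -> C x #<= elts m -> C x `<=` elts (M b)].

Lemma zempty_in a : ordinal a -> elts a !=set0 -> zempty ∈ a.
Proof.
move=> oa [b ba]; have o0 : ordinal (zempty : V).
  by split=> y /(@in_zempty V).
have [//|[a0|/in_zempty//]] := ordinal_total o0 oa.
by have := @in_zempty V b; rewrite a0.
Qed.

(** Codes [h] as one set, so that it can be a parameter of the models: [x] ranges over [P], [X] over
    the subsets of [W] and [i] over [W]. *)
Definition graph3 (h : V -> V -> V -> V) P W : V :=
  bigunion (zimage (fun x => bigunion (zimage (fun X => zimage
    (fun i => opair (opair x (opair X i)) (h x X i)) W) (zpow W))) P).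

Lemma in_graph3 h P W p : p ∈ graph3 h P W <-> exists x X i,
  [/\ x ∈ P, elts X `<=` elts W, i ∈ W &
      p = opair (opair x (opair X i)) (h x X i)].
Proof.
rewrite in_bigunion; split.
  move=> [y [/in_zimage[x [xP <-]] /in_bigunion[z [/in_zimage[X [/in_zpow XW <-]]]]]].
  by move=> /in_zimage[i [iW <-]]; exists x, X, i.
move=> [x [X [i [xP XW iW ->]]]].
exists (bigunion (zimage (fun X => zimage
    (fun i => opair (opair x (opair X i)) (h x X i)) W) (zpow W))).
split; first by apply/in_zimage; exists x.
apply/in_bigunion; exists (zimage (fun i => opair (opair x (opair X i)) (h x X i)) W).
split; first by apply/in_zimage; exists X; split=> //; exact/in_zpow.
by apply/in_zimage; exists i.
Qed.

(* The parameter f codes surjections h (x, X) of X onto C x, for X a subset of W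
   of size at least |C x|. The sequence of models up to a is an element of M b,
   hence so is X = W ∩ M a, which is large enough for a suitable a, and then so
   are all elements of C x, being definable from f, x, X and an element of X. *)
Lemma good_chain_exists (hCECA : CECA V) C P W l : cardinal l ->
  ~ countable (elts l) -> elts W #= elts l -> exists nu M, good_chain C P W l nu M.
Proof.
move=> cl ncl Wl; have ol := cardinal_ordinal cl.
have il : infinite_set (elts l) by move=> /finite_set_countable.
have W0 : elts W !=set0.
  exact/infinite_setN0/(infinite_le (card_eq_ge Wl)).
have /choice[h hP] : forall p : V * V, exists g : V -> V,
    C p.1 !=set0 -> C p.1 #<= elts p.2 ->
    forall c, C p.1 c -> exists i, i ∈ p.2 /\ g i = c.
  move=> [x X] /=; have [c0|c0] := pselect (C x !=set0); last by exists id.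
  have [cX|cX] := pselect (C x #<= elts X); last by exists id.
  by have [g [_ gP]] := card_leE_surj c0 cX; exists g => _ _ c /gP.
pose f := graph3 (fun x X => h (x, X)) P W.
(* The pair is the set that CECA puts into the first model, so every model contains both [f] and
   [W]. *)
have [theta [rt lt Hp]] := H_regular (opair f W) ol il.
have [ct it _] := rt; set D := H theta in Hp.
have Dtr x y : D x -> y ∈ x -> D y by exact: H_in.
have Dup x y : D x -> D y -> D (upair x y) by exact: H_upair.
have Dsu x y : elts y `<=` elts x -> D x -> D y by exact: H_subset.
have [Df DW] := (D_opair Dtr Dup f W).1 Hp.
have [||nu [M [[cfnu inc cont] [wc el small M0 cov]]]] :=
    hCECA l cl ncl theta rt lt W (opair f W) _ Hp Wl.
- by move=> x; exact: Dtr.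
- apply: finite_lt_infinite => //.
  suff -> : elts (opair f W) = [set upair f f; upair f W] by exact: finite_set2.
  by apply/seteqP; split=> z /in_upair.
have [onu _ _] := cfnu.
have mono x y : x ∈ y -> y ∈ nu -> elts (M x) `<=` elts (M y).
  by move=> xy /(inc x y xy)[].
have mono' x y : x ∈ y \/ x = y -> y ∈ nu -> elts (M x) `<=` elts (M y).
  by move=> [xy|->] ynu; [exact: mono xy ynu|exact: subset_refl].
(* If [nu] were the successor of [x], the last model [M x] would include [W], which is too large. *)
have nuS x : x ∈ nu -> succ x ∈ nu.
  move=> xnu; have ox := ordinal_in onu xnu.
  have [//|[e|/in_succ h']] := ordinal_total (ordinal_succ ox) onu; last first.
    case: (@zmem_irr V nu); case: h' => [nx|nx]; last by rewrite {1}nx.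
    exact: ordinal_trans nx.
  case: (card_ltNge (small x xnu)); apply: card_le_trans (card_eq_ge Wl) _.
  apply: subset_card_le => z /cov[y /=]; rewrite -[elts nu y]/(y ∈ nu) -e.
  by move=> /in_succ yx; exact: mono'.
(* Suppose that all traces of [W] are smaller than [m]. If [nu] is [l], then [l] is regular and the
   levels of [m] many points of [W] have a bound [b], so [M b] has a large trace. If [nu] is below
   [l], then [W] is a union of too few small traces. *)
have big m : m ∈ l -> exists a, a ∈ nu /\ elts m #<= elts W `&` elts (M a).
  move=> ml; apply: contrapT => nbig.
  have lts a : a ∈ nu -> elts W `&` elts (M a) #< elts m.
    move=> anu; rewrite -(elts_zsep W (elts (M a))).
    by apply: card_nle_lt => ma; apply: nbig; exists a; rewrite -elts_zsep.
  have [nul|nul] := is_cf_le ol cfnu.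
    subst nu.
    have [g [gW ginj]] := card_leE zempty (card_eq_ge Wl).
    have /choice[r rP] : forall i, exists a, i ∈ l -> a ∈ l /\ g i ∈ M a.
      move=> i; have [/gW/cov[a anu ga]|] := pselect (i ∈ l); first by exists a.
      by exists i.
    have mnu i : i ∈ m -> i ∈ l by exact: ordinal_trans.
    have [//|b [bnu rb]] := regular_bound cl (infinite_setN0 il) cfnu
      (in_cardinal cl ml) (f := r); first by move=> i /mnu/rP[].
    apply: (card_ltNge (lts b bnu)); apply: (@card_le_inj _ _ _ _ g).
      move=> i im; have [rnu gr] := rP i (mnu _ im); split; first exact/gW/mnu.
      exact: mono (rb i im) bnu _ gr.
    by move=> i j /mnu ? /mnu ?; exact: ginj.
  apply: (@card_ltNge _ _ (elts W) (elts l)); last exact: card_eq_ge.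
  suff -> : elts W = \bigcup_(a in elts nu) (elts W `&` elts (M a)).
    apply: bigcup_card_lt ml _ => //; first exact: in_cardinal.
    by move=> a /lts/card_ltW.
  apply/seteqP; split=> [z zW|z [a _ []]//].
  by have [a anu za] := cov z zW; exists a.
exists nu, M; split; split=> // m ml.
have [a0 [a0nu ma0]] := big m ml.
(* The clause of [in_chain] on sequences is stated at an index with some index below it. As [a0] may
   be empty, its successor is taken. *)
pose a := succ a0; have anu : a ∈ nu by exact: nuS.
have a0a : a0 ∈ a by apply/in_succ; right.
exists (succ a); split; first exact: nuS.
move=> b bnu ab x xb xP Cm c Cc.
have [elb ob] := (el b bnu, ordinal_in onu bnu).
have [_ /(_ (nuS _ anu))[s [sseq sM]]] := inc a0 a a0a anu.
have sb : s ∈ M b by exact: mono ab bnu _ sM.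
have [fb Wb] : elts (M b) f /\ elts (M b) W.
  apply: (sub_opairI Dtr Dup elb).
  have nu0 : zempty ∈ nu by apply: zempty_in => //; exists a.
  have /= := mono' zempty b _ bnu _ (M0 _ (@in_zempty V) nu0); apply.
  by left; apply: zempty_in => //; exists (succ a).
pose X := zsep W (elts (M a)).
(* The models increase and [s] ends with [M a], so the union of its values is [M a]. *)
have XE : X = union_of_values s W.
  apply: zfc_extensionality => z; rewrite !in_zsep; split=> -[zW]; split=> //.
    exists a, (M a); split=> //; rewrite -[_ ∈ s]/(elts s _) sseq.
    by exists a => //; apply/in_succ; right.
  case: b0 => i [y [+ zy]].
  rewrite -[_ ∈ s]/(elts s _) sseq => -[j /in_succ ja /opair_inj[_ yE]].
  by apply: (mono' j a ja anu); rewrite yE.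
have Xb : elts (M b) X by rewrite XE; exact: (sub_union_of_values Dtr Dup elb Dsu).
have CX : C x #<= elts X.
  apply: card_le_trans Cm (card_le_trans ma0 _); apply: subset_card_le => z [zW zM].
  by apply/in_zsep; split=> //; exact: mono a0a anu _ zM.
have [i [iX hi]] := hP (x, X) (ex_intro _ c Cc) CX c Cc.
have /in_zsep[iW iMa] := iX.
have ib : i ∈ M b.
  apply: (mono (succ a) b ab bnu); apply: (mono' a) iMa; last exact: nuS.
  by left; apply/in_succ; right.
have oo y : opair (opair x (opair X i)) y ∈ f <-> y = c.
  split=> [/in_graph3[x' [X' [i' [_ _ _]]]]|->].
    by move=> /opair_inj[/opair_inj[<- /opair_inj[<- <-]] ->].
  apply/in_graph3; exists x, X, i; split=> //; last by rewrite hi.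
  by move=> z /in_zsep[].
apply: (sub_apply Dtr Dup elb fb (x := opair x (opair X i))).
- by do !apply: (sub_opair Dtr Dup elb).
- exact/oo.
- by move=> y' /oo.
Qed.

End Chains.

(** * Filtrations into closed sets *)

Section Filtration.
Context {V : zfc}.
Implicit Types (x y z a b c l m nu P W : V) (M : V -> V) (C : V -> set V).

Definition closed_under C P (S : set V) : Prop :=
  forall x, x ∈ P -> S x -> C x `<=` S.

(** Two reasons for a closed level to exist above any given one: a uniform bound below [l], or
    individual bounds with [l] regular. *)
Definition few C P l : Prop :=
  (exists m, m ∈ l /\ forall x, x ∈ P -> C x #<= elts m) \/
  (is_cf l l /\ forall x, x ∈ P -> C x #< elts l).

(** With a uniform bound all late levels are closed. For regular [l] one has [nu] equal to [l]:
    [C x] is included in every level beyond [f x] that contains [x], and [N b] lies beyond [b] and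
    all [f x] with [x] in level [b]. Iterating [N] leads to a limit level, which is closed because
    by continuity each of its points appears at some earlier stage. *)
Lemma closed_unbounded C P W l nu M : cardinal l -> ~ countable (elts l) ->
  good_chain C P W l nu M -> few C P l ->
  forall a, a ∈ nu -> exists b, [/\ b ∈ nu, a ∈ b & closed_under C P (elts (M b))].
Proof.
move=> cl ncl [[onu cfnu mono cont] [_ small _ nuS clos]].
have ol := cardinal_ordinal cl.
have il : infinite_set (elts l) by move=> /finite_set_countable.
move=> [[m [ml Cm]] a anu|[cfl Cl]].
  have [a0 [a0nu a0P]] := clos m ml.
  have [c [cE oc ac a0c]] := ordinal_max (ordinal_in onu anu) (ordinal_in onu a0nu).
  have cnu : c ∈ nu by case: cE => ->.
  have le y : ordinal y -> elts y `<=` elts c -> y ∈ succ c.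
    by move=> oy /(ordinal_subset oy oc); rewrite in_succ.
  exists (succ c); split; [exact: nuS|exact: le (ordinal_in onu anu) ac|].
  move=> x xP xc; apply: a0P xc xP (Cm x xP); first exact: nuS.
  exact: le (ordinal_in onu a0nu) a0c.
have nul := is_cf_unique cfnu cfl; subst nu => a al.
have /choice[f fP] : forall x, exists c, x ∈ P -> c ∈ l /\
    forall b, b ∈ l -> c ∈ b -> x ∈ M b -> C x `<=` elts (M b).
  move=> x; have [xP|] := pselect (x ∈ P); last by exists x.
  have [m [_ ml Cm]] := lt_cardinal cl (Cl x xP).
  have [c [cl' cP]] := clos m ml; exists c => _; split=> // b bl cb xb.
  exact: cP bl cb x xb xP (card_eqW Cm).
have /choice[N NP] : forall b, exists c, b ∈ l ->
    [/\ c ∈ l, b ∈ c & forall x, x ∈ P -> x ∈ M b -> f x ∈ c].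
  move=> b; have [bl|] := pselect (b ∈ l); last by exists b.
  have [|c [cl' cP]] := regular_bound (A := elts (M b) `&` elts P) cl
      (infinite_setN0 il) cfl _ (f := f) (fun x h => (fP x h.2).1).
    apply: card_le_lt_trans (small b bl); exact: subset_card_le.
  have [d [dE od cd bd]] := ordinal_max (ordinal_in ol cl') (ordinal_succ (ordinal_in ol bl)).
  exists d => _; split; first by case: dE => -> //; exact: nuS.
    by apply: bd; apply/in_succ; right.
  by move=> x xP xb; apply: cd; exact: cP.
pose s n := iter n N a.
have sl n : s n ∈ l by elim: n => //= n /NP[].
have ss n : s n ∈ s n.+1 by have [] := NP _ (sl n).
(* Countably many elements of the uncountable regular [l] are bounded; the least strict bound [b] of
   the increasing [s n] is their supremum. *)
have [|d [dl dP]] := regular_bound (A := [set: nat]) cl (infinite_setN0 il) cfl _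
    (f := s) (fun n _ => sl n).
  rewrite /card_lt; apply/andP; split; first exact/infiniteP.
  by apply/negP.
have [b [ob sb bmin]] := ordinal_min (P := fun b => forall n, s n ∈ b)
  (ordinal_in ol dl) (fun n => dP n I).
have bl : b ∈ l.
  have [h|[->//|h]] := ordinal_total ob (ordinal_in ol dl).
    exact: ordinal_trans dl h.
  by case: (bmin d h) => n; exact: dP.
have below c : c ∈ b -> exists n, c ∈ s n.
  move=> /[dup] cb /bmin/existsNP[n nc].
  have [h|[cn|h]] := ordinal_total (ordinal_in ob cb) (ordinal_in ol (sl n)).
  - by exists n.
  - by exists n.+1; rewrite cn; exact: ss.
  - by case: nc.
have lim : limit_ordinal b.
  split=> //; first by exists (s 0%N); exact: sb.
  move=> y by_; have [|n yn] := below y; first by rewrite by_; apply/in_succ; right.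
  have /in_succ : s n ∈ succ y by rewrite -by_.
  case=> [ny|ny]; last by move: yn; rewrite ny => /zmem_irr.
  have oy : ordinal y by apply: ordinal_in ob _; rewrite by_; apply/in_succ; right.
  by apply: (@zmem_irr V y); exact: ordinal_trans ny yn.
exists b; split=> //; first exact: (sb 0%N).
move=> x xP; rewrite (cont b bl lim) => -[c cb xc].
have [n cn] := below c cb.
have xn : x ∈ M (s n) by exact: mono cn (sl n) _ xc.
have [_ _ fn] := NP _ (sl n).
have [_] := fP x xP; rewrite -(cont b bl lim); apply=> //.
  exact: ordinal_trans ob (sb n.+1) (fn x xP xn).
exact: mono (sb n) bl _ xn.
Qed.

Lemma weakly_closed_empty : weakly_closed (zempty : V).
Proof.
move=> t [_ it _] I [I0 It]; case: it.
apply: card_le_finite (card_eq_ge It) _.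
have -> : elts I = set0 by apply/seteqP; split=> // z /I0/in_zempty.
exact: finite_set0.
Qed.

(* r z is the rank of z in a filtration of W; S (r z) is the union of the
   earlier levels. It is closed because r z is never a limit of levels. *)
Lemma filtration C P W l nu M : cardinal l -> ~ countable (elts l) ->
  good_chain C P W l nu M -> few C P l ->
  exists r S : V -> V, forall z, z ∈ W ->
    [/\ ordinal (r z), ~ z ∈ S (r z), weakly_closed (S (r z)) &
        closed_under C P (elts (S (r z)))] /\
    [set w | w ∈ W /\ r w = r z] #< elts l /\
    forall w, w ∈ W -> r w ∈ r z -> w ∈ S (r z).
Proof.
move=> cl ncl gc fewC; have unb := closed_unbounded cl ncl gc fewC.
have [[onu cfnu mono cont] [wc small cov nuS _]] := gc.
pose G b := b ∈ nu /\ closed_under C P (elts (M b)).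
have /choice[r rP] : forall z, exists b, z ∈ W ->
    [/\ G b, z ∈ M b & forall c, c ∈ b -> ~ (G c /\ z ∈ M c)].
  move=> z; have [zW|] := pselect (z ∈ W); last by exists z.
  have [a anu za] := cov z zW; have [b [bnu ab bC]] := unb a anu.
  have [|c [_ [Gc zc] cmin]] :=
    ordinal_min (P := fun b => G b /\ z ∈ M b) (ordinal_in onu bnu).
    by split; [split|exact: mono ab bnu _ za].
  by exists c.
(* Separation from [M b] makes the union a set; as the chain increases, nothing is lost for [b] in
   [nu]. *)
pose S b := zsep (M b) [set x | exists c, [/\ c ∈ b, G c & x ∈ M c]].
have inS b x : b ∈ nu -> x ∈ S b <-> exists c, [/\ c ∈ b, G c & x ∈ M c].
  move=> bnu; rewrite in_zsep; split=> [[]//|[c [cb Gc xc]]].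
  by split; [exact: mono cb bnu _ xc|exists c].
exists r, S => z zW; have [Gr zr rmin] := rP z zW; have [rnu _] := Gr.
have zS : ~ z ∈ S (r z) by move=> /(inS _ _ rnu)[c [/rmin + Gc zc]]; apply.
have onr := ordinal_in onu rnu.
split; last split.
- suff [wS cS] : weakly_closed (S (r z)) /\ closed_under C P (elts (S (r z))) by [].
  (* Below [r z] there is no closed level, or a last one, or closed levels without a last one. The
     third case is impossible. *)
  have [none|/existsNP[c0 /contrapT [c0r Gc0]]] :=
      pselect (forall c, ~ (c ∈ r z /\ G c)).
    have -> : S (r z) = zempty.
      apply: elts_inj; apply/seteqP; split=> [x|x /in_zempty//].
      by move=> /(inS _ _ rnu)[c [cr Gc _]]; case: (none c).
    by split; [exact: weakly_closed_empty|move=> x _ /in_zempty].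
  have [[c [cr Gc cmax]]|nomax] := pselect (exists c, [/\ c ∈ r z, G c &
      forall c', c' ∈ r z -> G c' -> ~ c ∈ c']).
    suff -> : S (r z) = M c by split; [exact/wc/Gc.1|exact: Gc.2].
    apply: elts_inj; apply/seteqP; split=> x; last first.
      by move=> xc; apply/(inS _ _ rnu); exists c.
    move=> /(inS _ _ rnu)[c' [c'r Gc' xc']].
    have [h|[<-//|/(cmax _ c'r Gc')//]] :=
      ordinal_total (ordinal_in onr c'r) (ordinal_in onr cr).
    exact: mono h Gc.1 _ xc'.
  (* The supremum [d] of these closed levels is a limit, and by continuity its level is closed. If
     [d] is below [r z], it is an element of itself; if it equals [r z], then [z] appears in an
     earlier closed level. *)
  exfalso.
  have [//|d [od dG dmin]] := ordinal_min
    (P := fun d => forall c, c ∈ r z -> G c -> c ∈ d) onr.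
  have dle : d ∈ r z \/ d = r z.
    have [h|[h|/dmin h]] := ordinal_total od onr; [by left|by right|].
    by case: h.
  have dnu : d ∈ nu by case: dle => [h|->//]; exact: ordinal_trans rnu h.
  have below y : y ∈ d -> exists c, [/\ c ∈ r z, G c & y ∈ c].
    move=> /[dup] yd /dmin/existsNP[c /not_implyP[cr /not_implyP[Gc cy]]].
    have [h|[yc|//]] := ordinal_total (ordinal_in od yd) (ordinal_in onr cr).
      by exists c.
    apply: contrapT => h; apply: nomax; exists c; split=> // c' c'r Gc' cc'.
    by apply: h; exists c'; rewrite yc.
  have lim : limit_ordinal d.
    split=> //; first by exists c0; exact: dG.
    move=> y dy; have [|c [cr Gc yc]] := below y; first by rewrite dy; apply/in_succ; right.
    have := dG c cr Gc; rewrite dy in_succ => -[cy|cy].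
      by apply: (@zmem_irr V y); apply: ordinal_trans cy yc; apply: ordinal_in od _;
         rewrite dy; apply/in_succ; right.
    by move: yc; rewrite cy => /zmem_irr.
  have dM x : x ∈ M d -> exists c, [/\ c ∈ r z, G c & x ∈ M c].
    rewrite -[x ∈ M d]/(elts (M d) x) (cont d dnu lim) => -[y yd xy].
    have [c [cr Gc yc]] := below y yd; exists c; split=> //.
    exact: mono yc Gc.1 _ xy.
  have Gd : G d.
    split=> // x xP /dM[c [cr Gc xc]] u /(Gc.2 x xP xc).
    exact: mono (dG c cr Gc) dnu u.
  case: dle => [dr|dr]; first exact: (@zmem_irr V d (dG d dr Gd)).
  by have [|c [cr Gc zc]] := dM z; [rewrite dr|exact: (rmin c cr)].
- apply: card_le_lt_trans (small _ rnu); apply: subset_card_le => w [wW <-].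
  by have [] := rP w wW.
- move=> w wW wr; apply/inS => //; have [Gw ww _] := rP w wW.
  by exists (r w).
Qed.

End Filtration.

(** * Splitting families of sets *)

Section Splitting.
Context {V : zfc} (hCECA : CECA V) (sigma tau kappa : V) (A : V -> V).
Implicit Types (x y z a b k D I J S : V).
Hypotheses (hsigma : regular sigma) (htau : regular tau).
Hypothesis few_meet : forall I, subsets_card (elts kappa) tau I ->
  exists J, [/\ subsets_card_lt (elts I) tau J, elts J !=set0
    & \bigcap_(a in elts J) elts (A a) #<= elts sigma].
Hypothesis few_above : forall S,
  subsets_card (\bigcup_(a in elts kappa) elts (A a)) sigma S ->
  [set a | a ∈ kappa /\ elts S `<=` elts (A a)] #<= elts sigma \/
  [set a | a ∈ kappa /\ elts S `<=` elts (A a)] #< elts tau.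

Let U : set V := \bigcup_(a in elts kappa) elts (A a).

Lemma infinite_sigma : infinite_set (elts sigma).
Proof. by case: hsigma. Qed.

Lemma infinite_tau : infinite_set (elts tau).
Proof. by case: htau. Qed.

Lemma subset_union a : a ∈ kappa -> elts (A a) `<=` U.
Proof. by move=> ak x; exists a. Qed.

(* The elements of A that a parameter x, read as a set of indices, and the
   indices that x, read as a set of elements, force into a model. *)
Definition forced D x : set V :=
  [set c | [/\ subsets_card_lt (elts D) tau x, elts x !=set0,
      \bigcap_(a in elts x) elts (A a) #<= elts sigma
      & (\bigcap_(a in elts x) elts (A a)) c]] `|`
  [set a | subsets_card U sigma x /\ a ∈ D /\ elts x `<=` elts (A a)].

(** All subsets of the union of [D] and the sets of the family: a set containing every parameter of
    both kinds. *)
Definition params D : V := zpow (bigunion (upair D (bigunion (zimage A kappa)))).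

Lemma in_params D x : elts x `<=` elts D \/ elts x `<=` U -> x ∈ params D.
Proof.
move=> h; apply/in_zpow => z zx; apply/in_bigunion; case: h => h.
  by exists D; split; [apply/in_upair; left|exact: h].
exists (bigunion (zimage A kappa)); split; first by apply/in_upair; right.
have [a ak za] := h z zx; apply/in_bigunion; exists (A a); split=> //.
by apply/in_zimage; exists a.
Qed.

Lemma forced_meet_le D x :
  [set c | [/\ subsets_card_lt (elts D) tau x, elts x !=set0,
      \bigcap_(a in elts x) elts (A a) #<= elts sigma
      & (\bigcap_(a in elts x) elts (A a)) c]] #<= elts sigma.
Proof.
have [h|h] := pselect (\bigcap_(a in elts x) elts (A a) #<= elts sigma).
  by apply: card_le_trans h; apply: subset_card_le => c [].
apply: (@card_le_trans _ _ _ (set0 : set V)); last exact: card_ge0.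
by apply: subset_card_le => c [].
Qed.

Lemma forced_above D x : elts D `<=` elts kappa ->
  [set a | subsets_card U sigma x /\ a ∈ D /\ elts x `<=` elts (A a)] #<= elts sigma \/
  [set a | subsets_card U sigma x /\ a ∈ D /\ elts x `<=` elts (A a)] #< elts tau.
Proof.
move=> Dk; have [xU|h] := pselect (subsets_card U sigma x); last first.
  left; apply: (@card_le_trans _ _ _ (set0 : set V)); last exact: card_ge0.
  by apply: subset_card_le => c [].
have sub : [set a | subsets_card U sigma x /\ a ∈ D /\ elts x `<=` elts (A a)] `<=`
   [set a | a ∈ kappa /\ elts x `<=` elts (A a)] by move=> a [_ [/Dk]].
have [h|h] := few_above xU; [left|right].
  exact: card_le_trans (subset_card_le sub) h.
exact: card_le_lt_trans (subset_card_le sub) h.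
Qed.

Lemma forced_le D x y : elts D `<=` elts kappa -> infinite_set (elts y) ->
  elts sigma #<= elts y -> (elts D #<= elts y \/ elts tau #<= elts y) ->
  forced D x #<= elts y.
Proof.
move=> Dk iy sy Dy; apply: setU_card_le => //.
  exact: card_le_trans (forced_meet_le D x) sy.
case: Dy => [Dy|ty].
  by apply: card_le_trans Dy; apply: subset_card_le => a [_ []].
have [h|h] := forced_above x Dk; first exact: card_le_trans h sy.
exact: card_le_trans (card_ltW h) ty.
Qed.

Section Closed.
Variables (D S : V).
Hypotheses (Dk : elts D `<=` elts kappa) (wS : weakly_closed S).
Hypothesis cS : closed_under (forced D) (params D) (elts S).

(** Otherwise weak closure at tau gives a set [J] of tau indices from [I] all of whose small subsets
    are in [S]. One of these, [K], has a meet of at most sigma points, and it forces [y] into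
    [S]. *)
Lemma notin_closed_meet y I : ~ y ∈ S ->
  subsets_card (elts D `&` elts S) tau I -> exists a, a ∈ I /\ ~ y ∈ A a.
Proof.
move=> yS [IDS It]; apply: contrapT => h.
have yA a : a ∈ I -> y ∈ A a by move=> aI; apply: contrapT => n; apply: h; exists a.
have [|J [[JI Jt] JS]] := wS htau (I := I); first by split=> // a /IDS[].
have [|K [[KJ Kt] K0 Ks]] := @few_meet J.
  by split=> // a /JI/IDS[/Dk].
have KD : elts K `<=` elts D by move=> a /KJ/JI/IDS[].
apply: yS; apply: (cS (x := K)); first by apply: in_params; left.
  by apply: JS; split.
by left; split=> // a /KJ/JI/yA.
Qed.

(** Otherwise the trace has at least sigma-plus points, and weak closure at this regular cardinal
    [k] puts a subset [s] of the trace of size sigma into [S]. Then [s] forces [a] into [S]. *)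
Lemma notin_closed_trace a : a ∈ D -> ~ a ∈ S ->
  elts (A a) `&` elts S #<= elts sigma.
Proof.
move=> aD aS; apply: contrapT => h.
have [k [rk sk kmin]] := regular_succ infinite_sigma.
have [ck ik _] := rk.
have kA : elts k #<= elts (zsep (A a) (elts S)).
  apply: (nlt_ge (card_lexx _)) => /(lt_cardinal ck)[b [_ bk Ab]].
  apply: h; rewrite -elts_zsep; exact: card_le_trans (card_eqW Ab) (kmin b bk).
have [I [IA kI]] := equinumerous_elts kA.
rewrite elts_zsep in IA.
have [|J [[JI Jk] JS]] := wS rk (I := I).
  by split; [move=> x /IA[]|rewrite card_eq_sym].
have [s [sJ ss]] := equinumerous_elts (card_le_trans (card_ltW sk) (card_eq_ge Jk)).
have sA : elts s `<=` elts (A a) by move=> x /sJ/JI/IA[].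
have sU : elts s `<=` U by move=> x /sA; apply: subset_union; exact: Dk.
apply: aS; apply: (cS (x := s)); first by apply: in_params; right.
  apply: JS; split=> //; exact: card_le_lt_trans (card_eq_ge ss) sk.
by right; split; [split=> //; rewrite card_eq_sym|split].
Qed.

End Closed.

(** [X] is a late level of a chain at the successor [l] of the size of [x], so it has at most |x|
    elements. It is closed and includes [D], so [notin_closed_meet] applies to the points outside
    it. *)
Lemma heavy_points_le D x : elts D `<=` elts kappa -> infinite_set (elts x) ->
  elts sigma #<= elts x -> elts D #<= elts x ->
  exists X, elts X #<= elts x /\ forall y, ~ y ∈ X ->
    forall I, subsets_card (elts D) tau I -> exists a, a ∈ I /\ ~ y ∈ A a.
Proof.
move=> Dk ix sx Dx; have [l [rl xl lmin]] := regular_succ ix.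
have [cl il _] := rl; have ol := cardinal_ordinal cl.
have ncl : ~ countable (elts l).
  move=> cn; apply: (card_ltNge xl); apply: card_le_trans cn _.
  exact/infiniteP.
(* [D] is added to every determined set and, as a single point, to [W]: a late level that contains
   [D] as an element then includes it. *)
pose C y := forced D y `|` elts D.
have CD y : C y #<= elts x by apply: setU_card_le => //; apply: forced_le => //; left.
pose W := bigunion (upair l (upair D D)).
have WE : elts W = [set y | elts l y \/ y = D].
  apply/seteqP; split=> [y /in_bigunion[z [/in_upair[->|->]]]|y [yl|->]].
  - by left.
  - by move=> /in_upair[]; right.
  - by apply/in_bigunion; exists l; split=> //; apply/in_upair; left.
  - apply/in_bigunion; exists (upair D D).
    by split; apply/in_upair; [right|left].
have Wl : elts W #= elts l.
  apply/card_eqPle; rewrite WE; split; first exact: infinite_setU1_le.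
  by apply: subset_card_le => y; left.
have [nu [M [[onu cfnu mono cont] [wc small cov nuS clos]]]] :=
  good_chain_exists hCECA C (params D) cl ncl Wl.
have [m [cm ml xm]] := lt_cardinal cl xl.
have [a [anu aP]] := clos m ml.
have [|b bnu Db] := cov D; first by rewrite WE; right.
have [c [cE oc ac bc]] := ordinal_max (ordinal_in onu anu) (ordinal_in onu bnu).
have cnu : c ∈ nu by case: cE => ->.
have acS : a ∈ succ c by apply/in_succ/ordinal_subset => //; exact: ordinal_in onu anu.
have bcS : b ∈ succ c by apply/in_succ/ordinal_subset => //; exact: ordinal_in onu bnu.
have cSnu := nuS c cnu.
have clC y : y ∈ M (succ c) -> y ∈ params D -> C y `<=` elts (M (succ c)).
  move=> yM yP; apply: aP yM yP _ => //.
  exact: card_le_trans (CD y) (card_eqW xm).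
have DM : elts D `<=` elts (M (succ c)).
  move=> d dD; apply: (clC D) => //; [|by apply: in_params; left|by right].
  exact: mono bcS cSnu _ Db.
exists (M (succ c)); split.
  have [e [_ el Me]] := lt_cardinal cl (small _ cSnu).
  exact: card_le_trans (card_eqW Me) (lmin e el).
move=> y yM I [ID It]; apply: (@notin_closed_meet D (M (succ c))) => //.
- exact: wc.
- by move=> u uP uM v fv; apply: (clC u) => //; left.
- by split=> // d /ID dD; split=> //; exact: DM.
Qed.

(** The implication says that [x] is not in the difference of [A a] and [A' a], so for [kappa] this
    yields the conclusion of the theorem. *)
Definition splits D : Prop := exists A' : V -> V,
  (forall a, a ∈ D -> elts (A' a) #<= elts sigma) /\
  forall I x, subsets_card (elts D) tau I ->
    exists a, a ∈ I /\ (x ∈ A a -> x ∈ A' a).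

Lemma splits_all D : elts D `<=` elts kappa -> splits D.
Proof.
have [k [ck Dk]] := equinumerous_cardinal D.
elim/(@zmem_ind V): k D ck Dk => k IH D ck Dk Dkap.
have ok := cardinal_ordinal ck; have [csig _ _] := hsigma; have [ctau _ cftau] := htau.
have isig := infinite_sigma; have itau := infinite_tau.
have tauN0 I : subsets_card (elts D) tau I -> exists a, a ∈ I.
  by move=> [_ It]; exact: (infinite_setN0 (infinite_le (card_eq_ge It) itau)).
have [Dsig|sigD] := card_total D sigma.
  have [X [Xs XP]] := heavy_points_le Dkap isig (card_lexx _) Dsig.
  exists (fun=> X); split=> // I x ID.
  have [xX|xX] := pselect (x ∈ X).
    by have [a aI] := tauN0 I ID; exists a.
  by have [a [aI xa]] := XP x xX I ID; exists a.
(* With fewer than tau indices there is no [I] to consider. *)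
have [tauD|Dtau] := card_total tau D; last first.
  exists (fun=> zempty); split=> [a _|I x [ID It]].
    apply: (@card_le_trans _ _ _ (set0 : set V)); last exact: card_ge0.
    by apply: subset_card_le => z /in_zempty.
  case: (card_ltNge Dtau); apply: card_le_trans (card_eq_ge It) _.
  exact: subset_card_le.
have iD : infinite_set (elts D) := infinite_le (card_ltW sigD) isig.
have [X [XD XP]] := heavy_points_le Dkap iD (card_ltW sigD) (card_lexx _).
pose W := bigunion (upair D X).
have WE : elts W = elts D `|` elts X.
  apply/seteqP; split=> [y /in_bigunion[z [/in_upair[->|->]]]|y [yD|yX]].
  - by left.
  - by right.
  - by apply/in_bigunion; exists D; split=> //; apply/in_upair; left.
  - by apply/in_bigunion; exists X; split=> //; apply/in_upair; right.
have Wk : elts W #= elts k.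
  apply: card_eq_trans Dk; apply/card_eqPle; rewrite WE; split.
    exact: setU_card_le.
  by apply: subset_card_le; exact: subsetUl.
have sigk : elts sigma #< elts k := card_lt_le_trans sigD (card_eqW Dk).
have ik : infinite_set (elts k) := infinite_le (card_ltW sigk) isig.
have sigink : sigma ∈ k := lt_in_cardinal (cardinal_ordinal csig) ck sigk.
have nck : ~ countable (elts k).
  move=> cn; apply: (card_ltNge sigk); apply: card_le_trans cn _.
  exact/infiniteP.
(* If tau is below [k], the larger of sigma and tau is a uniform bound. Otherwise [k] is tau, which
   is regular, and each forced set is smaller than tau. *)
have fewk : few (forced D) (params D) k.
  have [tk|ktau] := pselect (tau ∈ k).
    left; have [m [mE om sm tm]] :=
      ordinal_max (cardinal_ordinal csig) (cardinal_ordinal ctau).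
    exists m; split=> [|x _]; first by case: mE => ->.
    apply: forced_le => //; try by [exact: subset_card_le|right; exact: subset_card_le].
    exact: infinite_le (subset_card_le sm) isig.
  have kE : k = tau.
    have [h|[//|//]] := ordinal_total ok (cardinal_ordinal ctau).
    case: (card_ltNge (in_cardinal ctau h)).
    exact: card_le_trans tauD (card_eqW Dk).
  right; split=> [|x _]; first by rewrite kE.
  apply: setU_card_lt => //.
    exact: card_le_lt_trans (forced_meet_le D x) sigk.
  have [h|h] := forced_above x Dkap; last by rewrite kE.
  exact: card_le_lt_trans h sigk.
have [nu [M gc]] := good_chain_exists hCECA (forced D) (params D) ck nck Wk.
have [r [S rS]] := filtration ck nck gc fewk.
have DW z : z ∈ D -> z ∈ W by move=> zD; rewrite -[z ∈ W]/(elts W z) WE; left.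
pose Q b := zsep D [set w | r w = b].
(* The indices of one rank are fewer than [k], so the induction hypothesis applies to them; [A] is a
   dummy value when [b] is not a rank. *)
have /choice[B BP] : forall b, exists A' : V -> V, (exists z, z ∈ W /\ r z = b) ->
    (forall a, a ∈ Q b -> elts (A' a) #<= elts sigma) /\
    forall I x, subsets_card (elts (Q b)) tau I ->
      exists a, a ∈ I /\ (x ∈ A a -> x ∈ A' a).
  move=> b; have [[z [zW rz]]|] := pselect (exists z, z ∈ W /\ r z = b);
    last by exists A.
  have [_ [small _]] := rS z zW.
  have Qk : elts (Q b) #< elts k.
    apply: card_le_lt_trans small; apply: subset_card_le => w /in_zsep[wD wb].
    by split; [exact: DW|rewrite rz].
  have [k' [ck' k'k Qk']] := lt_cardinal ck Qk.
  have [|A' A'P] := IH k' k'k (Q b) ck' Qk'; last by exists A'.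
  by move=> w /in_zsep[/Dkap].
exists (fun a => bigunion (upair (B (r a) a) (zsep (A a) (elts (S (r a)))))).
split=> [a aD|I x ID].
  have aW := DW a aD; have [[_ aS wS cS] _] := rS a aW.
  apply: (@card_le_trans _ _ _ (elts (B (r a) a) `|` (elts (A a) `&` elts (S (r a))))).
    apply: subset_card_le => z /in_bigunion[y [/in_upair[->|->]]]; first by left.
    by move=> /in_zsep; right.
  apply: setU_card_le => //; last exact: (notin_closed_trace Dkap wS cS).
  have [BQ _] := BP (r a) (ex_intro _ a (conj aW erefl)).
  by apply: BQ; apply/in_zsep.
apply: contrapT => hI.
have xP a : a ∈ I -> [/\ x ∈ A a, ~ x ∈ B (r a) a & ~ x ∈ S (r a)].
  move=> aI; have xA : x ∈ A a.
    by apply: contrapT => n; apply: hI; exists a.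
  split=> // h; apply: hI; exists a; split=> // _; apply/in_bigunion.
    by exists (B (r a) a); split=> //; apply/in_upair; left.
  exists (zsep (A a) (elts (S (r a)))).
  by split; [apply/in_upair; right|apply/in_zsep].
(* All sets with index in [I] contain [x], so [x] is in [X], hence in [W], and has a rank. *)
have xX : x ∈ X.
  apply: contrapT => xX; have [a [aI]] := XP x xX I ID.
  by apply; have [] := xP a aI.
have xW : x ∈ W by rewrite -[x ∈ W]/(elts W x) WE; right.
have [[orx xSx wSx cSx] [_ below]] := rS x xW.
have [IsD It] := ID.
have split_I a : a ∈ I -> a ∈ S (r x) \/ a ∈ Q (r x).
  move=> aI; have aD := IsD _ aI; have aW := DW a aD.
  have [[ora _ _ _] [_ belowa]] := rS a aW.
  have [h|[h|h]] := ordinal_total ora orx.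
  - by left; exact: below.
  - by right; apply/in_zsep.
  - by have [_ _ nS] := xP a aI; case: nS; exact: belowa.
have lt_tau (T : set V) : ~ (exists J, elts J `<=` elts I `&` T /\ elts J #= elts tau) ->
    elts I `&` T #< elts tau.
  move=> nJ; rewrite -elts_zsep; apply: card_nle_lt => h; apply: nJ.
  have [J [JI tJ]] := equinumerous_elts h; exists J.
  by rewrite -elts_zsep card_eq_sym.
have IS : elts I `&` elts (S (r x)) #< elts tau.
  apply: lt_tau => -[J [JIS Jt]].
  have [|a [aJ xa]] := notin_closed_meet Dkap wSx cSx xSx (I := J).
    by split=> // a /JIS[/IsD].
  by have [aI _] := JIS _ aJ; have [/xa] := xP a aI.
have IQ : elts I `&` elts (Q (r x)) #< elts tau.
  apply: lt_tau => -[J [JIQ Jt]].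
  have [_ BQ] := BP (r x) (ex_intro _ x (conj xW erefl)).
  have [|a [aJ xa]] := BQ J x; first by split=> // a /JIQ[].
  have [aI /in_zsep[_ ra]] := JIQ _ aJ; have [xA xB _] := xP a aI.
  by apply: xB; rewrite ra; exact: xa.
apply: (card_ltNge (setU_card_lt ctau itau IS IQ)).
apply: card_le_trans (card_eq_ge It) _; apply: subset_card_le => a aI.
by have [h|h] := split_I a aI; [left|right].
Qed.

End Splitting.

Theorem theorem2 (V : zfc) (hCECA : CECA V)
    (sigma tau kappa : V) (hsigma : regular sigma) (htau : regular tau)
    (hkappa : cardinal kappa) (A : V -> V)
    (hA :
      (forall I, subsets_card (elts kappa) tau I ->
         exists J, [/\ subsets_card_lt (elts I) tau J, elts J !=set0
           & \bigcap_(a in elts J) elts (A a) #< elts sigma])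
      \/
      ((forall I, subsets_card (elts kappa) tau I ->
         exists J, [/\ subsets_card_lt (elts I) tau J, elts J !=set0
           & \bigcap_(a in elts J) elts (A a) #<= elts sigma]) /\
       (forall S,
         subsets_card (\bigcup_(a in elts kappa) elts (A a)) sigma S ->
         [set a | a ∈ kappa /\ elts S `<=` elts (A a)] #<= elts sigma))) :
  exists A' : V -> V,
    (forall a, a ∈ kappa -> elts (A' a) #<= elts sigma) /\
    point_lt kappa tau (fun a => elts (A a) `\` elts (A' a)).
Proof.
have few_meet I : subsets_card (elts kappa) tau I ->
    exists J, [/\ subsets_card_lt (elts I) tau J, elts J !=set0
      & \bigcap_(a in elts J) elts (A a) #<= elts sigma].
  case: hA => [h /h[J [? ? /card_ltW ?]]|[h _]]; last exact: h.
  by exists J.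
have few_above S : subsets_card (\bigcup_(a in elts kappa) elts (A a)) sigma S ->
    [set a | a ∈ kappa /\ elts S `<=` elts (A a)] #<= elts sigma \/
    [set a | a ∈ kappa /\ elts S `<=` elts (A a)] #< elts tau.
  case: hA => [h [_ Ss]|[_ h]]; last by left; exact: h.
  (* Under the first condition, tau many sets including [S] would contain a subfamily whose meet has
     fewer than sigma points, yet this meet includes [S]. *)
  right; have -> : [set a | a ∈ kappa /\ elts S `<=` elts (A a)] =
      elts (zsep kappa [set a | elts S `<=` elts (A a)]) by rewrite elts_zsep.
  apply: card_nle_lt => /equinumerous_elts[I [Ik It]].
  rewrite elts_zsep in Ik.
  have [|J [[JI _] _ Jsig]] := h I.
    by split; [move=> a /Ik[]|rewrite card_eq_sym].
  apply: (card_ltNge Jsig); apply: card_le_trans (card_eq_ge Ss) _.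
  by apply: subset_card_le => z zS a /JI/Ik[_]; apply.
have [|A' [A's A'P]] := splits_all hCECA hsigma htau few_meet few_above (D := kappa).
  exact: subset_refl.
exists A'; split=> // I Ik; apply/seteqP; split=> // x xI.
have [a [aI]] := A'P I x Ik; have [xA xA'] := xI a aI.
by move=> /(_ xA).
Qed.
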